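(* Let $R=k[x_1,\ldots,x_r]$ be a polynomial ring over a field $k$, with a monomial order that respects total degree, and let $I=\langle f_1,\ldots,f_m\rangle\subseteq R$. Assume that: (1) $\mathrm{codim}(I)=2$; (2) $R/I$ is Cohen-Macaulay; (3) $I$ is homogeneous; (4) $f_1,\ldots,f_m$ are homogeneous with $\deg(f_1)=\cdots=\deg(f_m)$; (5) $\{f_1,\ldots,f_m\}$ is both a Gröbner basis and a minimal generating set of $I$. Let $\phi$ be a graded free presentation matrix for $I$ (an $m\times(m-1)$ matrix over $R$), and let $e_j$ be the common degree of the non-zero entries in the $j$-th column of $\phi$. Let $Y=\{Y_1,\ldots,Y_{m+1}\}$ and $Z=\{Z_1,\ldots,Z_{m-1}\}$ be new indeterminates and let $S=R[Y,Z]$, equipped with the inverse block order with respect to $\{Y,Z\}$; set $\deg(Y_i)=1$ for $1\le i\le m+1$ and $\deg(Z_j)=e_j$ for $1\leq j\leq m-1$. Let $\Phi$ be the $(m+1)\times m$ matrix $$\Phi=\begin{pmatrix} & & & Y_1\\ & \phi & & \vdots\\ & & & Y_m\\ Z_1&\cdots&Z_{m-1}&Y_{m+1}\end{pmatrix}.$$ Then the maximal minors of $\Phi$ form a Gröbner basis for the ideal $I_m(\Phi)\subseteq S$ generated by the $m\times m$ minors of $\Phi$.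
   Context: A monomial order respects total degree if $\deg m_1>\deg m_2$ implies $m_1>m_2$. For a nonzero polynomial $f$, $\mathrm{in}(f)$ is its largest term; $\mathrm{in}(I)=\langle\mathrm{in}(f):0\neq f\in I\rangle$; a subset $\{g_1,\ldots,g_n\}$ of $I$ is a Gröbner basis of $I$ if $\mathrm{in}(I)=\langle \mathrm{in}(g_1),\ldots,\mathrm{in}(g_n)\rangle$. Inverse block order: given a monomial order on $R=k[x_1,\ldots,x_r]$ and a monomial order on the polynomial ring $T$ over $k$ in the new indeterminates, the inverse block order on $S$ (polynomial ring in all variables) with respect to the new indeterminates is defined, for monomials $s_1,s_2\in R$ and $t_1,t_2\in T$, by: $s_1t_1<s_2t_2$ if either $s_1<s_2$, or $s_1=s_2$ and $t_1<t_2$. The monomial order on $T$ is arbitrary. Graded free presentation matrix: under (1)-(5), $R/I$ has a minimal graded free resolution $0\to\bigoplus_{j=1}^{m-1}R(-b_j)\xrightarrow{\phi}\bigoplus_{i=1}^m R(-a_i)\to R\to R/I\to 0$ with $a_i=\deg f_i$ and the basis of the middle module mapping to the generators $f_1,\ldots,f_m$; $\phi$ denotes the matrix of the first map, so its columns generate the syzygies of $(f_1,\ldots,f_m)$. The non-zero entries $\phi_{ij}$ are homogeneous of degree $b_j-a_i$, so all non-zero entries of one column have the same degree, and (Hilbert-Burch) up to a common unit $f_i$ is the signed maximal minor of $\phi$ obtained by deleting row $i$. *)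

(* Defs.v *)
From HB Require Import structures.
From mathcomp Require Import all_boot all_order all_algebra.
From mathcomp Require Import mpoly.

Set Implicit Arguments.
Unset Strict Implicit.
Unset Printing Implicit Defensive.

Import GRing.Theory.

Local Open Scope ring_scope.

Section Ideals.
Variable A : comNzRingType.
Implicit Types (I J P Q G : A -> Prop) (s : seq A).

Definition subideal I J := forall x, I x -> J x.

Definition eqideal I J := forall x, I x <-> J x.

Definition is_ideal I :=
  [/\ I 0, forall x y, I x -> I y -> I (x + y) & forall a x, I x -> I (a * x)].

Definition ideal_gen G : A -> Prop := fun x =>
  exists (n : nat) (c g : 'I_n -> A),
    (forall i, G (g i)) /\ x = \sum_(i < n) c i * g i.

Definition ideal_seq s : A -> Prop := ideal_gen (fun x => x \in s).

Definition is_prime_ideal P :=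
  [/\ is_ideal P, ~ P 1 & forall x y, P (x * y) -> P x \/ P y].

Definition is_maximal_ideal P :=
  [/\ is_ideal P, ~ P 1 &
      forall J, is_ideal J -> ~ J 1 -> subideal P J -> subideal J P].

(* There is a chain Q 0 < Q 1 < ... < Q n = P of prime ideals. *)
Definition height_ge P (n : nat) :=
  exists Q : nat -> A -> Prop,
    [/\ forall i, (i <= n)%N -> is_prime_ideal (Q i),
        forall i, (i < n)%N ->
          subideal (Q i) (Q i.+1) /\ ~ subideal (Q i.+1) (Q i) &
        eqideal (Q n) P].

Definition height_is P n := height_ge P n /\ ~ height_ge P n.+1.

(* The codimension of an ideal is the least height of a prime containing it. *)
Definition codim_is I (n : nat) :=
  (exists P, [/\ is_prime_ideal P, subideal I P & height_is P n]) /\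
  (forall P, is_prime_ideal P -> subideal I P -> height_ge P n).

Definition regular_sequence s :=
  (forall i, (i < size s)%N ->
     forall y, ideal_seq (take i s) (s`_i * y) -> ideal_seq (take i s) y) /\
  ~ ideal_seq s 1.

(* The largest length of a regular sequence of A with terms in P is n. *)
Definition depth_is P (n : nat) :=
  (exists s,
     [/\ regular_sequence s, forall x, x \in s -> P x & size s = n]) /\
  (forall s,
     regular_sequence s -> (forall x, x \in s -> P x) -> (size s <= n)%N).

End Ideals.

(* depth (P, A) = codim P for every maximal ideal P; for Noetherian A (the   *)
(* only case of interest) both numbers are finite.                           *)
Definition cohen_macaulay (A : comNzRingType) :=
  forall P : A -> Prop, is_maximal_ideal P ->
    exists n, depth_is P n /\ height_is P n.

(* A / I is Cohen-Macaulay, where A / I is any ring B that comes with a      *)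
(* surjective ring morphism pi from A to B with kernel I.                    *)
Definition cohen_macaulay_quotient (A : comNzRingType) (I : A -> Prop) :=
  exists (B : comNzRingType) (pi : {rmorphism A -> B}),
    [/\ forall y, exists x, pi x = y,
        forall x, pi x = 0 <-> I x &
        cohen_macaulay B].

(* A monomial order is given by its strict part lt; the monomial 0%MM is 1   *)
(* and monomials are multiplied by adding exponents.                         *)
Record monomial_order (n : nat) (lt : rel 'X_{1..n}) : Prop := MonomialOrder {
  mo_irr : forall u, ~~ lt u u;
  mo_trans : forall u v w, lt u v -> lt v w -> lt u w;
  mo_total : forall u v, u != v -> lt u v || lt v u;
  mo_mul : forall u v w, lt u v -> lt (u + w)%MM (v + w)%MM;
  mo_one : forall u, u != 0%MM -> lt 0%MM u
}.

Definition respects_total_degree (n : nat) (lt : rel 'X_{1..n}) :=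
  forall u v, (mdeg v < mdeg u)%N -> lt v u.

Section Groebner.
Variables (k : fieldType) (n : nat) (lt : rel 'X_{1..n}).
Implicit Types (p : {mpoly k[n]}) (I : {mpoly k[n]} -> Prop).

Definition mono_max (u v : 'X_{1..n}) := if lt u v then v else u.

(* 0%MM is the least monomial, hence neutral for mono_max. *)
Definition lead_mono p : 'X_{1..n} := \big[mono_max/0%MM]_(u <- msupp p) u.

Definition in_term p : {mpoly k[n]} := p@_(lead_mono p) *: 'X_[lead_mono p].

(* The ideal generated by the initial terms of the nonzero elements of the   *)
(* set F, which need not be an ideal.                                        *)
Definition initial_ideal (F : {mpoly k[n]} -> Prop) : {mpoly k[n]} -> Prop :=
  ideal_gen (fun t => exists p, [/\ F p, p != 0 & t = in_term p]).

Definition groebner_basis I (G : seq {mpoly k[n]}) :=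
  (forall g, g \in G -> I g) /\
  eqideal (initial_ideal I) (initial_ideal (fun g => g \in G)).

End Groebner.

Definition homogeneous_ideal (k : fieldType) (n : nat)
    (I : {mpoly k[n]} -> Prop) :=
  forall p d, I p -> I (pihomog mdeg d p).

Definition minimal_generators (A : comNzRingType) (m : nat) (f : 'I_m -> A)
    (I : A -> Prop) :=
  eqideal (ideal_seq (codom f)) I /\
  forall J : {set 'I_m}, J \proper setT ->
    ~ eqideal (ideal_gen (fun x => exists2 i, i \in J & x = f i)) I.

(* phi is the matrix of the first map of a minimal graded free resolution    *)
(*   0 -> (+)_j R(- b j) -> (+)_i R(- a i) -> R -> R / <f> -> 0              *)
(* whose second map sends the i-th basis vector to f i.                      *)
Record graded_free_presentation (k : fieldType) (r m n : nat)
    (f : 'I_m -> {mpoly k[r]}) (a : 'I_m -> nat) (b : 'I_n -> nat)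
    (phi : 'M[{mpoly k[r]}]_(m, n)) : Prop := GradedFreePresentation {
  gfp_homog : forall i j, phi i j != 0 ->
    (a i <= b j)%N /\ phi i j \is (b j - a i).-homog;
  gfp_exact : forall v : 'cV[{mpoly k[r]}]_m,
    \sum_(i < m) f i * v i 0 = 0 <-> exists w : 'cV_n, v = phi *m w;
  gfp_inj : forall w : 'cV[{mpoly k[r]}]_n, phi *m w = 0 -> w = 0;
  gfp_minimal : forall i j, (phi i j)@_0%MM = 0
}.

(* The first r variables are those of R, the last t are the new ones. *)
Definition inverse_block_order (r t : nat) (ltR : rel 'X_{1..r})
    (ltT : rel 'X_{1..t}) : rel 'X_{1..(r + t)} := fun u v =>
  let uR := [multinom u (lshift t i) | i < r] in
  let vR := [multinom v (lshift t i) | i < r] in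
  let uT := [multinom u (rshift r i) | i < t] in
  let vT := [multinom v (rshift r i) | i < t] in
  ltR uR vR || ((uR == vR) && ltT uT vT).

Definition mpoly_lshift (k : fieldType) (r t : nat) (p : {mpoly k[r]}) :
    {mpoly k[r + t]} := p \mPo [tuple 'X_(lshift t i) | i < r].

Definition increasing (l p : nat) : {set {ffun 'I_l -> 'I_p}} :=
  [set s : {ffun 'I_l -> 'I_p} |
    [forall i : 'I_l, forall j : 'I_l, (i < j)%N ==> (s i < s j)%N]].

Definition minors (A : comNzRingType) (l p q : nat) (M : 'M[A]_(p, q)) :
    seq A :=
  [seq \det (mxsub s t M) | s : {ffun 'I_l -> 'I_p} <- enum (increasing l p),
                            t : {ffun 'I_l -> 'I_q} <- enum (increasing l q)].
Arguments minors {A} l {p q} M.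

Section BigMatrix.
Variables (k : fieldType) (r m : nat).

(* After the r variables of R come Y_1, ..., Y_{m+1}, Z_1, ..., Z_{m-1}. *)
Definition Yvar (i : 'I_(m + 1)) : {mpoly k[r + ((m + 1) + m.-1)]} :=
  'X_(rshift r (lshift m.-1 i)).

Definition Zvar (j : 'I_m.-1) : {mpoly k[r + ((m + 1) + m.-1)]} :=
  'X_(rshift r (rshift (m + 1) j)).

Definition Phi_mx (phi : 'M[{mpoly k[r]}]_(m, m.-1)) :
    'M[{mpoly k[r + ((m + 1) + m.-1)]}]_(m + 1, m.-1 + 1) :=
  block_mx (map_mx (@mpoly_lshift k r _) phi) (\col_i Yvar (lshift 1 i))
           (\row_j Zvar j)                    (const_mx (Yvar (rshift m ord0))).

End BigMatrix.

(* Main.v *)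
(**
Put Delta_i for the signed maximal minor of phi that omits row i.  Exactness of
the presentation and McCoy's theorem give f_i = h Delta_i for one polynomial h,
so the Delta_i inherit from the f_i that their initial terms generate the
initial ideal of (Delta_1, ..., Delta_m).

Let E be the sum of the e_j.  The maximal minors of Phi are, up to sign,
D = sum_i Delta_i Y_i and M_i = Delta_i Y_{m+1} + (terms of x-degree < E),
and the columns of Phi are syzygies of (M_1, ..., M_m, D).  Take
p = sum_i A_i M_i + B D with A_i, B of x-degree at most N.  By the last column,
B may be assumed free of Y_{m+1}.  The part of p of x-degree N + E is
Y_{m+1} sum_i A_i' Delta_i + B' D, where A_i' and B' are the parts of x-degree N.
If it is nonzero it carries the initial term of p, since the order compares
x-degrees first; its two summands share no monomial, since only the first is
divisible by Y_{m+1}, so the initial term is divisible by that of some M_i or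
of D.  If it vanishes, then B' = 0 and (A_i') is a combination of columns of
phi; subtracting the same combination of columns of Phi lowers N, because the
entries Z_j have x-degree 0 < e_j.
*)
Require Import Defs.
From HB Require Import structures.
From mathcomp Require Import all_boot all_order all_algebra.
From mathcomp Require Import fingroup perm mpoly ring.

Set Implicit Arguments.
Unset Strict Implicit.
Unset Printing Implicit Defensive.

Import GRing.Theory.

Local Open Scope ring_scope.

(** * Ideals generated by a set *)

Section IdealClosure.
Variables (A : comNzRingType) (N : A -> Prop).
Hypothesis idealN : is_ideal N.

Lemma ideal_sum (J : Type) (s : seq J) (P : pred J) (F : J -> A) :
  (forall i, P i -> N (F i)) -> N (\sum_(i <- s | P i) F i).
Proof.
by case: idealN => N0 ND _ NF; elim/big_rec: _ => // i x Pi; apply/ND/NF.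
Qed.

End IdealClosure.

Lemma ideal_gen_is_ideal (A : comNzRingType) (G : A -> Prop) :
  is_ideal (ideal_gen G).
Proof.
split=> [|x y [n1 [c1 [g1 [G1 ->]]]] [n2 [c2 [g2 [G2 ->]]]]|a x [n [c [g [Gg
  ->]]]]].
- by exists 0%N, (fun=> 0), (fun=> 0); split; [case | rewrite big_ord0].
- exists (n1 + n2)%N.
  exists (fun i => match split i with inl j => c1 j | inr j => c2 j end).
  exists (fun i => match split i with inl j => g1 j | inr j => g2 j end).
  split=> [i|]; first by case: (split i).
  rewrite big_split_ord; congr (_ + _); apply: eq_bigr => i _.
    by rewrite -[lshift _ _]/(unsplit (inl i)) unsplitK.
  by rewrite -[rshift _ _]/(unsplit (inr i)) unsplitK.
- exists n, (fun i => a * c i), g; split=> //.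
  by rewrite mulr_sumr; apply: eq_bigr => i _; rewrite mulrA.
Qed.

Lemma mem_ideal_gen (A : comNzRingType) (G : A -> Prop) x :
  G x -> ideal_gen G x.
Proof.
move=> Gx; exists 1%N, (fun=> 1), (fun=> x); split=> //.
by rewrite big_ord1 mul1r.
Qed.

Lemma ideal_gen_sub (A : comNzRingType) (G N : A -> Prop) x :
  is_ideal N -> (forall y, G y -> N y) -> ideal_gen G x -> N x.
Proof.
move=> idN GN [n [c [g [Gg ->]]]]; apply: ideal_sum => // i _.
by case: idN => _ _; apply; apply: GN.
Qed.

(** * McCoy's theorem and the Hilbert-Burch factorization *)

(* McCoy's theorem for phi modulo N: were p not in N, cofactors of a smaller *)
(* minor not killed by p would give a nonzero kernel vector of phi mod N.    *)
Lemma mccoy (A : comNzRingType) (N : A -> Prop) (m n : nat)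
    (phi : 'M[A]_(m, n)) (p : A) :
    is_ideal N ->
    (forall w : 'cV_n, (forall i, N ((phi *m w) i 0)) -> forall j, N (w j 0)) ->
    (forall s : 'I_n -> 'I_m, N (p * \det (rowsub s phi))) ->
  N p.
Proof.
move=> idN injN killN.
(* Induction on l: p sends all minors of size n - l into N, from the maximal minors down to the
   empty minor 1. *)
have killl l : (l <= n)%N ->
    forall (s : 'I_(n - l) -> 'I_m) (g : 'I_(n - l) -> 'I_n),
    N (p * \det (mxsub s g phi)).
  elim: l => [|l IHl] lt_ln s g.
    move: s g; rewrite subn0 => s g.
    have -> : mxsub s g phi = rowsub s phi *m colsub g 1%:M.
      by rewrite mulmx_colsub mulmx1 -mxsub_comp.
    rewrite det_mulmx mulrA mulrC.
    by case: idN => _ _ /(_ _ _ (killN s)).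
  move: (IHl (ltnW lt_ln)); rewrite (_ : n - l = (n - l.+1).+1)%N; last first.
    by rewrite -subSn.
  set t := (n - l.+1)%N in s g * => IH.
  have [j0 j0P] : exists j0, j0 \notin codom g.
    apply/existsP; rewrite -[X in is_true X]negbK negb_exists; apply/negP =>
      /forallP gP.
    have : (n <= t)%N.
      rewrite -[n]card_ord -[t]card_ord -(size_image g).
      apply: leq_trans (card_size _); apply/subset_leq_card/subsetP => j _.
      by have:= gP j; rewrite negbK.
    by rewrite leqNgt /t ltn_subrL // (leq_ltn_trans _ lt_ln).
  (* The column j0 outside the image of g is put in front. The cofactors along a new first row,
     times p, form w, summed over repeated columns of g; entry j0 of w is p times the given
     minor. *)
  pose g' (j : 'I_t.+1) := oapp g j0 (unlift ord0 j).
  pose cf (j : 'I_t.+1) := (-1) ^+ j * \det (mxsub s (g' \o lift j) phi).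
  pose w := \col_j (\sum_(c | g' c == j) p * cf c).
  (* Entry i is p times the minor of size t + 1 with rows i and s, expanded along its first row. *)
  have wN i : N ((phi *m w) i 0).
    rewrite mxE.
    pose s' (a : 'I_t.+1) := oapp s i (unlift ord0 a).
    suff -> : \sum_j phi i j * w j 0 = p * \det (mxsub s' g' phi) by apply: IH.
    rewrite (expand_det_row _ ord0) mulr_sumr.
    rewrite (partition_big g' predT) //=; apply: eq_bigr => j _.
    rewrite mxE mulr_sumr; apply: eq_bigr => c /eqP <-.
    rewrite !mxE /s' unlift_none /= mulrCA; congr (_ * (_ * _)).
    rewrite /cofactor add0n; congr (_ * \det _); apply/matrixP => a b.
    by rewrite !mxE /= liftK.
  have := injN _ wN j0.
  rewrite mxE (big_pred1 ord0) => [|c].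
    rewrite /cf expr0 mul1r; congr (N (p * \det _)).
    by apply/matrixP => a b; rewrite !mxE /= /g' liftK.
  rewrite /g'; case: unliftP => [c' ->|->] /=; last by rewrite !eqxx.
  by apply/negbTE; apply: contra j0P => /eqP <-; apply: codom_f.
have absurd_ord (T : Type) : 'I_0 -> T by case.
have := killl n (leqnn n); rewrite subnn => /(_ (absurd_ord _) (absurd_ord _)).
by rewrite det_mx00 mulr1.
Qed.

(** * Signed maximal minors *)

Section SignedMinors.
Variables (A : comNzRingType) (q : nat).
Implicit Type M : 'M[A]_(q.+1, q).

Definition signed_minor M (i : 'I_q.+1) := (-1) ^+ i * \det (row' i M).

(** Laplace expansion along the prepended column: its cofactors carry exactly the signs of
    [signed_minor]. *)
Lemma det_row_mx_signed_minor M (c : 'cV_q.+1) :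
  \det (row_mx c M : 'M_(1 + q)) = \sum_i c i 0 * signed_minor M i.
Proof.
rewrite (expand_det_col _ (lshift q 0)); apply: eq_bigr => i _.
rewrite row_mxEl /cofactor addn0; congr (_ * (_ * \det _)).
apply/matrixP => a b; rewrite !mxE.
have -> : lift (lshift q (0 : 'I_1)) b = rshift 1 b by apply: val_inj.
by case: splitP => [[[]]|j /= [/val_inj ->]].
Qed.

(** Prepending column j of M to M repeats it, so the determinant vanishes. *)
Lemma signed_minor_syzygy M j : \sum_i M i j * signed_minor M i = 0.
Proof.
have := det_row_mx_signed_minor M (col j M).
under [X in _ = X]eq_bigr do rewrite mxE.
move<-; rewrite -det_tr.
apply: (@determinant_alternate _ _ _ (lshift q 0) (rshift 1 j)) => // i.
by rewrite !mxE (unsplitK (inl _)) (unsplitK (inr _)) mxE.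
Qed.

(** For B = (e_l | M), the row f B is (f_l, 0, ..., 0) and det B is the l-th signed minor.
    Multiplying f B by the adjugate of B gives the identity without any division. *)
Lemma signed_minor_proportional M (f : 'I_q.+1 -> A) :
    (forall j, \sum_i f i * M i j = 0) ->
  forall i l, f i * signed_minor M l = f l * signed_minor M i.
Proof.
move=> fM i l.
pose c : 'cV[A]_q.+1 := delta_mx l 0.
pose B : 'M_(1 + q) := row_mx c M.
pose fr : 'rV_(1 + q) := \row_i f i.
have detB : \det B = signed_minor M l.
  rewrite det_row_mx_signed_minor (bigD1 l) //= mxE !eqxx mul1r big1 ?addr0 //.
  by move=> a /negbTE a_l; rewrite mxE a_l mul0r.
have fB : fr *m B = row_mx (f l)%:M 0.
  rewrite mul_mx_row; congr row_mx.
    apply/matrixP => a b; rewrite !ord1 !mxE (bigD1 l) //= !mxE !eqxx mulr1.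
    by rewrite big1 ?addr0 // => j /negbTE j_l; rewrite !mxE j_l mulr0.
  by apply/matrixP => a j; rewrite !mxE; under eq_bigr do rewrite mxE;
    apply: fM.
have : fr *m B *m \adj B = \det B *: fr.
  by rewrite -mulmxA mul_mx_adj mul_mx_scalar.
move/matrixP/(_ 0 i); rewrite fB detB !mxE mulrC => <-.
rewrite (bigD1 (lshift q 0)) //= row_mxEl mxE mulr1n big1 ?addr0.
  rewrite mxE; congr (_ * _); rewrite /cofactor addn0; congr (_ * \det _).
  apply/matrixP => a b; rewrite !mxE.
  have -> : lift (lshift q (0 : 'I_1)) b = rshift 1 b by apply: val_inj.
  by case: splitP => [[[]]|j /= [/val_inj ->]].
move=> j; rewrite -[j]splitK; case: (split j) => b /=;
  first by rewrite ord1 eqxx.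
by rewrite row_mxEr mxE mul0r.
Qed.

(** Some index i is missed by s, so s factors through [lift i] and the selected matrix is a square
    matrix times M without row i. If s is not injective, the factor is 0. *)
Lemma det_rowsub_signed_minor M (s : 'I_q -> 'I_q.+1) :
  exists i c, \det (rowsub s M) = c * signed_minor M i.
Proof.
have [i iP] : exists i, i \notin codom s.
  apply/existsP; rewrite -[X in is_true X]negbK negb_exists; apply/negP =>
    /forallP sP.
  suff: (q.+1 <= q)%N by rewrite ltnn.
  rewrite -[X in (X <= _)%N]card_ord -[X in (_ <= X)%N]card_ord -(size_image s).
  apply: leq_trans (card_size _); apply/subset_leq_card/subsetP => j _.
  by have:= sP j; rewrite negbK.
exists i.
have sE a : exists b, s a == lift i b.
  case: (unliftP i (s a)) => [b ->|sa]; first by exists b.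
  by move: iP; rewrite -sa codom_f.
pose g a := xchoose (sE a).
exists (\det (rowsub g 1%:M) * (-1) ^+ i).
rewrite /signed_minor mulrA -[_ * _ * (-1) ^+ i]mulrA -expr2 sqrr_sign mulr1.
rewrite -det_mulmx mul_rowsub_mx mul1mx; congr (\det _).
by apply/matrixP => a b; rewrite !mxE (eqP (xchooseP (sE a))).
Qed.

End SignedMinors.

Section HilbertBurch.
Variables (A : idomainType) (q : nat).
Variables (phi : 'M[A]_(q.+1, q)) (f : 'I_q.+1 -> A).
Hypothesis inj_phi : forall w : 'cV_q, phi *m w = 0 -> w = 0.

(** McCoy's theorem with N = 0 and p = 1. *)
Lemma signed_minor_neq0 : exists i, signed_minor phi i != 0.
Proof.
apply/existsP; rewrite -[X in is_true X]negbK negb_exists; apply/negP =>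
  /forallP m0.
have /eqP : 1 = 0 :> A; last by rewrite oner_eq0.
apply: (@mccoy _ (fun x => x = 0) _ _ phi).
- by split=> // [x y -> ->|a x ->]; rewrite ?addr0 ?mulr0.
- move=> w w0 j; rewrite (inj_phi (w := w)) ?mxE //.
  by apply/matrixP => i b; rewrite ord1 w0 mxE.
- move=> s; rewrite mul1r; have [i [c ->]] := det_rowsub_signed_minor phi s.
  by have := m0 i; rewrite negbK => /eqP ->; rewrite mulr0.
Qed.

Hypothesis exact_phi : forall v : 'cV_q.+1,
  \sum_i f i * v i 0 = 0 <-> exists w : 'cV_q, v = phi *m w.

(** McCoy's theorem for the ideal N generated by one nonzero minor a, with p = f j. If phi w = a v,
    then f v = 0, so v = phi w' by exactness and w = a w' by injectivity; the products of f j with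
    the minors lie in N by proportionality. *)
Lemma hilbert_burch : exists h, forall i, f i = h * signed_minor phi i.
Proof.
have fphi j : \sum_i f i * phi i j = 0.
  have [_] := exact_phi (col j phi).
  under eq_bigr do rewrite mxE.
  by apply; exists (delta_mx j 0); rewrite colE.
have prop := signed_minor_proportional fphi.
have [j a0] := signed_minor_neq0; set a := signed_minor phi j in a0.
(* Proportionality spreads divisibility from j to every i: f i * a = f j * [signed_minor phi i], and
   a cancels. *)
suff [h fj] : exists h, f j = h * a.
  exists h => i; apply: (mulIf a0).
  by rewrite prop fj mulrAC.
pose N x := exists h, x = h * a.
have idN : is_ideal N.
  split=> [|_ _ [h1 ->] [h2 ->]|b _ [h ->]].
  - by exists 0; rewrite mul0r.
  - by exists (h1 + h2); rewrite mulrDl.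
  - by exists (b * h); rewrite mulrA.
apply: (@mccoy _ N _ _ phi) => // [w /fin_all_exists[v wv] l|s].
  have [w' vE] : exists w' : 'cV_q, \col_i v i = phi *m w'.
    apply/exact_phi; apply: (mulIf a0); rewrite mul0r mulr_suml.
    under eq_bigr do rewrite mxE -mulrA -wv mxE mulr_sumr.
    rewrite exchange_big big1 // => l' _ /=.
    by under eq_bigr do rewrite mulrA; rewrite -mulr_suml fphi mul0r.
  exists (w' l 0); suff -> : w = a *: w' by rewrite mxE mulrC.
  apply/eqP; rewrite -subr_eq0; apply/eqP/inj_phi.
  rewrite mulmxBr -scalemxAr -vE; apply/matrixP => i b.
  by rewrite ord1 mxE wv !mxE mulrC subrr.
have [i [c ->]] := det_rowsub_signed_minor phi s.
by exists (c * f i); rewrite mulrCA -prop mulrA.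
Qed.

End HilbertBurch.

(** The equation [l = q] is a hypothesis because it is used for [n.+1] and [n + 1], which are not
    convertible. *)
Lemma maximal_minor_signed_minor (A : comNzRingType) (l q : nat)
    (M : 'M[A]_(q.+1, q)) x :
  l = q -> x \in minors l M -> exists i c, x = c * signed_minor M i.
Proof.
move=> lq; subst q; case/allpairsP=> -[s t] [_ _ ->].
have [i [c sE]] := det_rowsub_signed_minor M s.
exists i, (\det (colsub t (1%:M : 'M[A]_l)) * c).
rewrite -mulrA -sE mulrC -det_mulmx mulmx_colsub mulmx1; congr (\det _).
by rewrite -mxsub_comp.
Qed.

Lemma det_row'_minors (A : comNzRingType) (l q : nat) (M : 'M[A]_(q.+1, q)) i :
  l = q -> \det (row' i M) \in minors l M.
Proof.
move=> lq; subst q.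
have -> : row' i M = mxsub [ffun a => lift i a] [ffun b => b] M.
  by apply/matrixP => a b; rewrite !mxE !ffunE.
apply: allpairs_f; rewrite mem_enum inE; apply/forallP => a; apply/forallP => b;
  apply/implyP => ab; rewrite !ffunE //=.
by rewrite ltnNge leq_bump2 -ltnNge.
Qed.

(** * Leading monomials *)

Section LeadMono.
Variables (n : nat) (lt : rel 'X_{1..n}).
Hypothesis lt_mo : monomial_order lt.

(** A relation rather than a function: the zero polynomial has no lead, while [lead_mono] gives it
    the default [0%MM]. *)
Definition is_lead (A : nzRingType) (p : {mpoly A[n]}) (w : 'X_{1..n}) :=
  p@_w != 0 /\ forall u, p@_u != 0 -> u = w \/ lt u w.

Lemma is_lead_uniq (A : nzRingType) (p : {mpoly A[n]}) u v :
  is_lead p u -> is_lead p v -> u = v.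
Proof.
case=> pu maxu [pv maxv].
have [//|ltuv] := maxv _ pu; have [//|ltvu] := maxu _ pv.
by have := mo_irr lt_mo u; rewrite (mo_trans lt_mo ltuv ltvu).
Qed.

Lemma is_lead_lead_mono (k : fieldType) (p : {mpoly k[n]}) :
  p != 0 -> is_lead p (lead_mono lt p).
Proof.
rewrite -msupp_eq0 => p0.
have maxP (s : seq 'X_{1..n}) : s != [::] ->
    let w := \big[mono_max lt/0%MM]_(u <- s) u in
    w \in s /\ forall u, u \in s -> u = w \/ lt u w.
  elim: s => // a s IH _; rewrite big_cons.
  have [->|s0] := eqVneq s [::].
    rewrite big_nil /mono_max; case: ifP => [lta0|_]; last first.
      by split=> [|u]; rewrite inE // => /eqP; left.
    (* The fold starts from [0%MM], so [lt a 0%MM] has to be excluded: 1 is the least monomial. *)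
    have [a0|/(mo_one lt_mo) lt0a] := eqVneq a 0%MM.
      by have := mo_irr lt_mo 0%MM; rewrite -{1}a0 lta0.
    by have := mo_irr lt_mo a; rewrite (mo_trans lt_mo lta0 lt0a).
  have [] := IH s0; set w := \big[_/_]_(u <- s) u => ws maxw.
  rewrite /mono_max; case: ifP => [ltaw|lt'aw].
    split=> [|u]; rewrite inE ?ws ?orbT // => /predU1P[->|/maxw //].
    by right.
  split=> [|u]; rewrite inE ?eqxx // => /predU1P[->|]; first by left.
  have [<-|wa] := eqVneq w a; first by move/maxw.
  have ltwa : lt w a by move: (mo_total lt_mo wa); rewrite lt'aw orbF.
  by move/maxw=> [->|ltuw]; right=> //; apply: mo_trans ltuw ltwa.
have [] := maxP _ p0.
rewrite mcoeff_msupp => pw maxw.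
by split=> // u; rewrite -mcoeff_msupp => /maxw.
Qed.

Lemma lead_monoE (k : fieldType) (p : {mpoly k[n]}) w :
  is_lead p w -> lead_mono lt p = w.
Proof.
move=> lead_w; apply: (is_lead_uniq _ lead_w).
by apply: is_lead_lead_mono; apply: contraTneq lead_w.1 => ->;
  rewrite mcoeff0 eqxx.
Qed.

(** The monomial [u + v] arises from only one pair of monomials of p and q, so its coefficient is a
    product of nonzero elements of a domain. *)
Lemma is_leadM (A : idomainType) (p q : {mpoly A[n]}) u v :
  is_lead p u -> is_lead q v -> is_lead (p * q) (u + v)%MM.
Proof.
move=> [pu maxu] [qv maxv].
have le w1 w2 : w1 = u \/ lt w1 u -> w2 = v \/ lt w2 v ->
    (w1, w2) = (u, v) \/ lt (w1 + w2)%MM (u + v)%MM.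
  move=> [->|lt1] [->|lt2]; [by left| right..].
  - by rewrite ![(u + _)%MM]addmC; apply: mo_mul.
  - exact: mo_mul.
  - apply: mo_trans (mo_mul lt_mo _ lt1) _ => //.
    by rewrite ![(u + _)%MM]addmC; apply: mo_mul.
split=> [|w].
  suff -> : (p * q)@_(u + v) = p@_u * q@_v by rewrite mulf_neq0.
  rewrite {1}(mpolyE p) mulr_suml raddf_sum /=.
  rewrite (bigD1_seq u) ?msupp_uniq ?mcoeff_msupp //= big1_seq => [|a].
    by rewrite addr0 -scalerAl mcoeffZ -commr_mpolyX mcoeffMX.
  rewrite mcoeff_msupp => /andP[au pa]; apply/eqP; rewrite -[_ == 0]negbK.
  rewrite -scalerAl mcoeffZ -commr_mpolyX; apply/negP;
    rewrite mulf_eq0 negb_or => /andP[_].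
  rewrite -mcoeff_msupp => /msuppM_le /allpairsP[[b c] /= [bq]].
  rewrite msuppX inE => /eqP -> uv.
  have := le _ _ (maxu _ pa) (maxv b _); rewrite -mcoeff_msupp =>
    /(_ bq)[[aE _]|].
    by rewrite aE eqxx in au.
  by rewrite uv addmC (negbTE (mo_irr lt_mo _)).
rewrite -mcoeff_msupp => /msuppM_le /allpairsP[[b c] /= []].
rewrite !mcoeff_msupp => /maxu bu /maxv cv ->.
by have [[-> ->]|] := le _ _ bu cv; [left | right].
Qed.

End LeadMono.

(** * Monomials in two blocks and the inverse block order *)

Section BlockMonomials.
Variables r t : nat.
Implicit Types (w : 'X_{1..(r + t)}) (u : 'X_{1..r}) (v : 'X_{1..t}).

Definition lmnm w : 'X_{1..r} := [multinom w (lshift t i) | i < r].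
Definition rmnm w : 'X_{1..t} := [multinom w (rshift r i) | i < t].
Definition cat_mnm u v : 'X_{1..(r + t)} :=
  [multinom match split i with inl j => u j | inr j => v j end | i < r + t].

Lemma lmnm_cat u v : lmnm (cat_mnm u v) = u.
Proof. by apply/mnmP => i; rewrite !mnmE (unsplitK (inl _)). Qed.

Lemma rmnm_cat u v : rmnm (cat_mnm u v) = v.
Proof. by apply/mnmP => i; rewrite !mnmE (unsplitK (inr _)). Qed.

Lemma cat_mnmK w : cat_mnm (lmnm w) (rmnm w) = w.
Proof.
by apply/mnmP => i; rewrite mnmE; case: splitP => j ij; rewrite mnmE;
  congr (w _); apply: val_inj.
Qed.

Lemma lmnmD w1 w2 : lmnm (w1 + w2) = (lmnm w1 + lmnm w2)%MM.
Proof. by apply/mnmP => i; rewrite !mnmE. Qed.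

Lemma rmnmD w1 w2 : rmnm (w1 + w2) = (rmnm w1 + rmnm w2)%MM.
Proof. by apply/mnmP => i; rewrite !mnmE. Qed.

Lemma eq_block_mnm w1 w2 :
  (w1 == w2) = (lmnm w1 == lmnm w2) && (rmnm w1 == rmnm w2).
Proof.
apply/eqP/andP => [-> //|[/eqP eql /eqP eqr]].
by rewrite -(cat_mnmK w1) eql eqr cat_mnmK.
Qed.

Lemma le_block_mnm w1 w2 :
  (lmnm w1 <= lmnm w2)%MM -> (rmnm w1 <= rmnm w2)%MM -> (w1 <= w2)%MM.
Proof.
move=> /mnm_lepP lel /mnm_lepP ler; apply/mnm_lepP => i.
by rewrite -(cat_mnmK w1) -(cat_mnmK w2) [X in (X <= _)%N]mnmE [X in (_ <=
  X)%N]mnmE; case: (split i).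
Qed.

Variables (ltR : rel 'X_{1..r}) (ltT : rel 'X_{1..t}).
Hypotheses (ltR_mo : monomial_order ltR) (ltT_mo : monomial_order ltT).

Lemma inverse_block_orderE w1 w2 :
  inverse_block_order ltR ltT w1 w2 =
    ltR (lmnm w1) (lmnm w2)
    || (lmnm w1 == lmnm w2) && ltT (rmnm w1) (rmnm w2).
Proof. by []. Qed.

Lemma inverse_block_order_mo : monomial_order (inverse_block_order ltR ltT).
Proof.
split=> [u|u v w|u v|u v w|u]; rewrite !inverse_block_orderE.
- by rewrite negb_or negb_and (mo_irr ltR_mo) (mo_irr ltT_mo) orbT.
- case/orP=> [ltuv|/andP[/eqP -> ltuv]]; case/orP=> [ltvw|/andP[/eqP <- ltvw]].
  + by rewrite (mo_trans ltR_mo ltuv ltvw).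
  + by rewrite ltuv.
  + by rewrite ltvw.
  + by rewrite eqxx (mo_trans ltT_mo ltuv ltvw) orbT.
- rewrite eq_block_mnm [lmnm v == _]eq_sym; case: eqVneq =>
  [->|/(mo_total ltR_mo)] /=.
    by case/(mo_total ltT_mo)/orP=> ->; rewrite !orbT.
  by case/orP=> ->; rewrite ?orbT.
- rewrite !lmnmD !rmnmD.
  case/orP=> [ltuv|/andP[/eqP -> ltuv]]; first by rewrite (mo_mul ltR_mo).
  by rewrite eqxx (mo_mul ltT_mo) ?orbT.
- have l0 : lmnm 0%MM = 0%MM by apply/mnmP => i; rewrite !mnmE.
  have r0 : rmnm 0%MM = 0%MM by apply/mnmP => i; rewrite !mnmE.
  rewrite eq_block_mnm l0 r0 [0%MM == _]eq_sym; case: eqVneq =>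
    [->|/(mo_one ltR_mo) -> //].
  by move/(mo_one ltT_mo) ->; rewrite orbT.
Qed.

End BlockMonomials.

(** * Polynomials in the new variables over R *)

Section SplitMPoly.
Variables (k : fieldType) (r t : nat).
Implicit Types (p : {mpoly k[r + t]}) (P : {mpoly {mpoly k[r]}[t]}).

(** The isomorphism from k[x,T] to k[x][T]; degrees in the old variables are then read off
    coefficientwise. *)
Definition split_mpoly p : {mpoly {mpoly k[r]}[t]} :=
  mmap (@mpolyC t {mpoly k[r]} \o @mpolyC r k)
    (fun i => match split i with inl j => ('X_j)%:MP | inr j => 'X_j end) p.

Fact split_mpoly_additive : additive split_mpoly.
Proof. exact: mmap_is_additive. Qed.

Fact split_mpoly_multiplicative : multiplicative split_mpoly.
Proof. exact: mmap_is_multiplicative. Qed.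

HB.instance Definition _ :=
  GRing.isAdditive.Build {mpoly k[r + t]} {mpoly {mpoly k[r]}[t]} split_mpoly
    split_mpoly_additive.
HB.instance Definition _ :=
  GRing.isMultiplicative.Build {mpoly k[r + t]} {mpoly {mpoly k[r]}[t]}
    split_mpoly
    split_mpoly_multiplicative.

Lemma split_mpolyX w : split_mpoly 'X_[w] = 'X_[lmnm w] *: 'X_[rmnm w].
Proof.
rewrite /split_mpoly mmapX /mmap1 big_split_ord /= -mul_mpolyC; congr (_ * _).
  rewrite (mpolyXE_id _ (lmnm w)) rmorph_prod; apply: eq_bigr => i _.
  by rewrite (unsplitK (inl _)) rmorphXn mnmE.
rewrite (mpolyXE_id _ (rmnm w)); apply: eq_bigr => i _.
by rewrite (unsplitK (inr _)) mnmE.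
Qed.

Lemma split_mpolyZ c p : split_mpoly (c *: p) = c%:MP *: split_mpoly p.
Proof. by rewrite /split_mpoly mmapZ /= mul_mpolyC. Qed.

Lemma split_mpolyE p : split_mpoly p =
  \sum_(w <- msupp p) (p@_w *: 'X_[lmnm w]) *: 'X_[rmnm w].
Proof.
rewrite [in LHS](mpolyE p) (raddf_sum split_mpoly); apply: eq_bigr => w _ /=.
by rewrite split_mpolyZ split_mpolyX scalerA mul_mpolyC.
Qed.

Lemma mcoeff_split_mpoly p w : (split_mpoly p)@_(rmnm w)@_(lmnm w) = p@_w.
Proof.
rewrite split_mpolyE [in RHS](mpolyE p) !raddf_sum /=; apply: eq_bigr => a _.
rewrite !mcoeffZ !mcoeffX eq_block_mnm.
case: (rmnm a == _); rewrite /= ?(andbT, andbF, mulr1, mulr0, mcoeff0) //.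
by rewrite mcoeffZ mcoeffX.
Qed.

Lemma mcoeff_split_mpoly_cat p u v : (split_mpoly p)@_v@_u = p@_(cat_mnm u v).
Proof. by rewrite -mcoeff_split_mpoly lmnm_cat rmnm_cat. Qed.

Lemma split_mpoly_surj P : exists p, split_mpoly p = P.
Proof.
exists (\sum_(v <- msupp P) \sum_(u <- msupp P@_v) P@_v@_u *: 'X_[cat_mnm u v]).
rewrite [RHS]mpolyE (raddf_sum split_mpoly); apply: eq_bigr => v _ /=.
rewrite (raddf_sum split_mpoly) [in RHS](mpolyE P@_v) scaler_suml;
  apply: eq_bigr => u _ /=.
by rewrite split_mpolyZ split_mpolyX lmnm_cat rmnm_cat scalerA mul_mpolyC.
Qed.

Lemma split_mpoly_lshift q : split_mpoly (mpoly_lshift t q) = q%:MP.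
Proof.
rewrite /mpoly_lshift [in RHS](mpolyE q) [q in LHS]mpolyE.
rewrite (raddf_sum (comp_mpoly _)) (raddf_sum split_mpoly).
rewrite (raddf_sum (@mpolyC t _)); apply: eq_bigr => u _ /=.
rewrite comp_mpolyZ split_mpolyZ -!mul_mpolyC.
rewrite rmorphM /=; congr (_ * _).
rewrite comp_mpolyX rmorph_prod mpolyXE_id rmorph_prod; apply: eq_bigr => i _.
rewrite !rmorphXn tnth_mktuple /= split_mpolyX; congr (_ ^+ _).
have -> : rmnm U_(lshift t i)%MM = 0%MM by apply/mnmP => j;
  rewrite !mnmE eq_lrshift.
have -> : lmnm U_(lshift t i)%MM = U_(i)%MM by apply/mnmP => j;
  rewrite !mnmE eq_lshift.
by rewrite mpolyX0 -mul_mpolyC mulr1.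
Qed.

Lemma split_mpoly_rshift i : split_mpoly 'X_(rshift r i) = 'X_i.
Proof.
rewrite split_mpolyX.
have -> : rmnm U_(rshift r i)%MM = U_(i)%MM by apply/mnmP => j;
  rewrite !mnmE eq_rshift.
have -> : lmnm U_(rshift r i)%MM = 0%MM by apply/mnmP => j;
  rewrite !mnmE eq_rlshift.
by rewrite mpolyX0 scale1r.
Qed.

Variables (ltR : rel 'X_{1..r}) (ltT : rel 'X_{1..t}).
Hypotheses (ltR_mo : monomial_order ltR) (ltT_mo : monomial_order ltT).

(** The lead for the inverse block order seen through [split_mpoly]: the monomial u of a coefficient
    is compared before v. *)
Definition is_block_lead P (u : 'X_{1..r}) (v : 'X_{1..t}) :=
  P@_v@_u != 0 /\ forall u' v', P@_v'@_u' != 0 ->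
    [\/ u' = u /\ v' = v, ltR u' u | u' = u /\ ltT v' v].

Lemma is_lead_split p w :
  is_lead (inverse_block_order ltR ltT) p w <->
  is_block_lead (split_mpoly p) (lmnm w) (rmnm w).
Proof.
rewrite /is_block_lead mcoeff_split_mpoly; split=> [] [pw maxw]; split=> //.
  move=> u v; rewrite mcoeff_split_mpoly_cat => /maxw.
  rewrite inverse_block_orderE lmnm_cat rmnm_cat.
  case=> [<-|/orP[ltu|/andP[/eqP eu ltv]]].
  - by rewrite lmnm_cat rmnm_cat; constructor 1.
  - by constructor 2.
  - by constructor 3.
move=> w'; rewrite -mcoeff_split_mpoly inverse_block_orderE => /maxw.
case=> [[eu ev]|->|[-> ->]]; [left|by right|by right; rewrite eqxx orbT].
by apply/eqP; rewrite eq_block_mnm eu ev !eqxx.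
Qed.

(** Both factors are pulled back along [split_mpoly] to k[x,T], where leads multiply and are
    unique. *)
Lemma is_block_leadM P Q u v :
  is_block_lead (P * Q) u v ->
  exists u1 u2 v1 v2, [/\ is_block_lead P u1 v1, is_block_lead Q u2 v2,
    u = (u1 + u2)%MM & v = (v1 + v2)%MM].
Proof.
have [p <-] := split_mpoly_surj P; have [q <-] := split_mpoly_surj Q.
rewrite -rmorphM => lead_uv.
have /is_lead_split lead_pq : is_block_lead (split_mpoly (p * q))
    (lmnm (cat_mnm u v)) (rmnm (cat_mnm u v)) by rewrite lmnm_cat rmnm_cat.
have mo := inverse_block_order_mo ltR_mo ltT_mo.
have /andP[p0 q0] : (p != 0) && (q != 0).
  by rewrite -negb_or -mulf_eq0; apply: contraTneq lead_pq.1 => ->;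
    rewrite mcoeff0 eqxx.
have leadp := is_lead_lead_mono mo p0; have leadq := is_lead_lead_mono mo q0.
have wE := is_lead_uniq mo lead_pq (is_leadM mo leadp leadq).
exists (lmnm (lead_mono (inverse_block_order ltR ltT) p)).
exists (lmnm (lead_mono (inverse_block_order ltR ltT) q)).
exists (rmnm (lead_mono (inverse_block_order ltR ltT) p)).
exists (rmnm (lead_mono (inverse_block_order ltR ltT) q)).
split; [exact/is_lead_split | exact/is_lead_split | |].
  by rewrite -lmnmD -wE lmnm_cat.
by rewrite -rmnmD -wE rmnm_cat.
Qed.

End SplitMPoly.

(** * The degree in the old variables *)

Section DegreeBounds.
Variables (k : fieldType) (r : nat).
Implicit Types p q : {mpoly k[r]}.

Lemma msize_leP d p :
  (msize p <= d)%N <-> forall u, (d <= mdeg u)%N -> p@_u = 0.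
Proof.
split=> [le_pd u le_du|p0].
  exact/memN_msupp_eq0/msize_mdeg_ge/(leq_trans le_pd).
rewrite msizeE big_seq; elim/big_rec: _ => // u x pu le_xd.
rewrite geq_max le_xd andbT ltnNge; apply: contraL pu => /p0.
by rewrite mcoeff_msupp => ->; rewrite eqxx.
Qed.

Lemma mcoeff_pihomog d p u :
  (pihomog mdeg d p)@_u = if mdeg u == d then p@_u else 0.
Proof.
have -> : (if mdeg u == d then p@_u else 0) =
    \sum_(w <- msupp p) if mdeg u == d then (p@_w *: 'X_[w])@_u else 0.
  by case: ifP => _; [rewrite {1}(mpolyE p) raddf_sum | rewrite big1].
rewrite pihomogE raddf_sum big_mkcond; apply: eq_bigr => w _ /=.
by rewrite mcoeffZ mcoeffX; case: (eqVneq w u) => [->//|_];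
  rewrite mulr0 !if_same.
Qed.

Lemma homog_mcoeff d p u : p \is d.-homog -> p@_u != 0 -> mdeg u = d.
Proof. by move=> /dhomogP hp; rewrite -mcoeff_msupp => /hp. Qed.

Lemma msize_homog d p : p \is d.-homog -> (msize p <= d.+1)%N.
Proof.
move=> hp; apply/msize_leP => u lt_du; apply: (dhomog_nemf_coeff hp).
by rewrite gtn_eqF.
Qed.

Lemma pihomogM d e p q : p \is e.-homog ->
  pihomog mdeg d (p * q) = if (e <= d)%N then p * pihomog mdeg (d - e) q else 0.
Proof.
move=> hp.
have monoE u : pihomog mdeg d (p * 'X_[u]) =
    if (e <= d)%N then p * pihomog mdeg (d - e) 'X_[u] else 0.
  have hpu : p * 'X_[u] \is (e + mdeg u).-homog.
    by apply: dhomogM => //; rewrite dhomogX.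
  rewrite pihomogX; case: (eqVneq (e + mdeg u)%N d) => [<-|ne].
    by rewrite leq_addr addKn eqxx pihomog_dE.
  rewrite (pihomog_ne0 ne hpu); case: leqP => // le_ed.
  by case: eqVneq => [uE|]; [rewrite uE subnKC ?eqxx in ne | rewrite mulr0].
rewrite {1 2}(mpolyE q) mulr_sumr !linear_sum /=.
transitivity (\sum_(w <- msupp q) q@_w *:
    if (e <= d)%N then p * pihomog mdeg (d - e) 'X_[w] else 0).
  by apply: eq_bigr => w _; rewrite -scalerAr linearZ /= monoE.
case: ifP => _; last by rewrite big1 // => w _; rewrite scaler0.
rewrite mulr_sumr; apply: eq_bigr => w _.
by rewrite [in RHS]linearZ /= scalerAr.
Qed.

Variable t : nat.
Implicit Types P Q : {mpoly {mpoly k[r]}[t]}.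

(* msize is the degree plus one, so P has degree less than d in the old      *)
(* variables; deg_lt 0 P means P = 0.                                        *)
Definition deg_lt (d : nat) P := forall v, (msize P@_v <= d)%N.

Lemma deg_ltP d P :
  deg_lt d P <-> forall v u, (d <= mdeg u)%N -> P@_v@_u = 0.
Proof. by split=> PP v; apply/msize_leP/PP. Qed.

Lemma deg_lt0 P : deg_lt 0 P -> P = 0.
Proof. by move=> /deg_ltP P0; apply/mpolyP => v; apply/mpolyP => u;
  rewrite P0 ?mcoeff0. Qed.

Lemma deg_lt_zero d : deg_lt d 0.
Proof. by move=> v; rewrite mcoeff0 msize0. Qed.

Lemma deg_ltW d d' P : (d <= d')%N -> deg_lt d P -> deg_lt d' P.
Proof. by move=> le Pd v; apply: leq_trans le. Qed.

Lemma deg_ltD d P Q : deg_lt d P -> deg_lt d Q -> deg_lt d (P + Q).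
Proof.
move=> /deg_ltP Pd /deg_ltP Qd; apply/deg_ltP => v u le_du.
by rewrite !mcoeffD Pd ?Qd ?addr0.
Qed.

Lemma deg_ltN d P : deg_lt d P -> deg_lt d (- P).
Proof. by move=> Pd v; rewrite mcoeffN msizeN. Qed.

Lemma deg_lt_sum d (J : Type) (s : seq J) (B : pred J) F :
  (forall i, B i -> deg_lt d (F i)) -> deg_lt d (\sum_(i <- s | B i) F i).
Proof.
move=> Fd; elim/big_ind: _ => //; [exact: deg_lt_zero | exact: deg_ltD].
Qed.

(** P has degree less than a and Q degree at most b, hence the bound [b.+1]. *)
Lemma deg_ltM a b P Q :
  deg_lt a P -> deg_lt b.+1 Q -> deg_lt (a + b) (P * Q).
Proof.
move=> Pa Qb; apply/deg_ltP => v u le_ab; apply/eqP.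
rewrite mcoeffM raddf_sum big1 //= => -[v1 v2] _ /=.
apply/memN_msupp_eq0/msize_mdeg_ge/(leq_trans _ le_ab).
have [->|p0] := eqVneq P@_v1 0; first by rewrite mul0r msize0.
have [->|q0] := eqVneq Q@_v2 0; first by rewrite mulr0 msize0.
by rewrite msizeM // -ltnS prednK ?ltn_addr ?lt0n ?msize_poly_eq0 // -addnS
  leq_add.
Qed.

Lemma mcoeff_homogM d1 d2 P Q :
    (forall v, P@_v \is d1.-homog) -> (forall v, Q@_v \is d2.-homog) ->
  forall v, (P * Q)@_v \is (d1 + d2).-homog.
Proof. by move=> Pa Qb v; rewrite mcoeffM; apply: rpred_sum => w _;
  apply: dhomogM. Qed.

Lemma deg_ltZ a b p P :
  (msize p <= a)%N -> deg_lt b.+1 P -> deg_lt (a + b) (p *: P).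
Proof.
move=> pa; rewrite -mul_mpolyC; apply: deg_ltM => v.
by rewrite mcoeffC; case: (v == _); rewrite ?mulr1 // mulr0 msize0.
Qed.

Lemma deg_ltX v : deg_lt 1 'X_[v].
Proof. by move=> w; rewrite mcoeffX; case: (_ == _);
  rewrite ?msize0 ?msize1. Qed.

Definition homog_part d P := map_mpoly (pihomog mdeg d) P.

Lemma mcoeff_homog_part d P v : (homog_part d P)@_v = pihomog mdeg d P@_v.
Proof. exact: mcoeff_map_mpoly. Qed.

Lemma deg_lt_sub_homog_part d P :
  deg_lt d.+1 P -> deg_lt d (P - homog_part d P).
Proof.
move=> /deg_ltP Pd; apply/deg_ltP => v u.
rewrite !mcoeffB mcoeff_homog_part mcoeff_pihomog leq_eqVlt eq_sym.
by case: eqP => /= [_ _|_ /(Pd v) ->]; rewrite subrr.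
Qed.

Variable ltR : rel 'X_{1..r}.
Variable ltT : rel 'X_{1..t}.
Hypotheses (ltR_mo : monomial_order ltR) (ltR_deg : respects_total_degree ltR).

(** All monomials of Q are smaller than the lead, since [ltR] respects total degree. *)
Lemma is_block_leadD_deg_lt d P Q u v :
    (forall w, P@_w \is d.-homog) -> deg_lt d Q ->
  is_block_lead ltR ltT P u v -> is_block_lead ltR ltT (P + Q) u v.
Proof.
move=> Pd /deg_ltP Qd [Puv maxP]; have du := homog_mcoeff (Pd v) Puv.
split=> [|u' v']; first by rewrite !mcoeffD Qd ?du // addr0.
have [le_d|lt_d _] := leqP d (mdeg u').
  by rewrite !mcoeffD (Qd _ _ le_d) addr0 => /maxP.
by constructor 2; apply: ltR_deg; rewrite du.
Qed.

(** A nonzero P has a monomial of degree d, which beats every monomial of Q; so the lead has degree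
    at least d, where P + Q and P agree. *)
Lemma is_block_lead_top d P Q u v :
    (forall w, P@_w \is d.-homog) -> P != 0 -> deg_lt d Q ->
  is_block_lead ltR ltT (P + Q) u v -> is_block_lead ltR ltT P u v.
Proof.
move=> Pd P0 /deg_ltP Qd [PQuv maxPQ].
have PQE u' v' : (d <= mdeg u')%N -> (P + Q)@_v'@_u' = P@_v'@_u'.
  by move=> le_d; rewrite !mcoeffD (Qd _ _ le_d) addr0.
have [v1 [u1 P1]] : exists v1 u1, P@_v1@_u1 != 0.
  have P'0 := P0; rewrite -mleadc_eq0 in P0.
  by exists (mlead P), (mlead P@_(mlead P)); rewrite mleadc_eq0.
have d1 := homog_mcoeff (Pd v1) P1.
have du : (d <= mdeg u)%N.
  rewrite -d1 leqNgt; apply/negP => ltuu1.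
  have := maxPQ u1 v1; rewrite PQE ?d1 // => /(_ P1).
  case=> [[u1E _]|ltu1u|[u1E _]]; rewrite ?u1E ?ltnn // in ltuu1.
  by have := mo_irr ltR_mo u; rewrite (mo_trans ltR_mo (ltR_deg ltuu1) ltu1u).
split=> [|u' v' P']; first by rewrite -PQE.
by apply: maxPQ; rewrite PQE // (homog_mcoeff (Pd v') P').
Qed.

End DegreeBounds.

(** * Separating one new variable *)

Section FreeOf.
Variables (k : fieldType) (r t : nat) (y : 'I_t).
Implicit Types P Q : {mpoly {mpoly k[r]}[t]}.

Definition free_of P := forall v, P@_v != 0 -> v y = 0%N.

Lemma free_ofM P Q : free_of P -> free_of Q -> free_of (P * Q).
Proof.
move=> Py Qy v; rewrite -mcoeff_msupp => /msuppM_le /allpairsP[[v1 v2] /= []].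
by rewrite !mcoeff_msupp => /Py P1 /Qy Q2 ->; rewrite mnmDE P1 Q2.
Qed.

Lemma mcoeff_free_of P (v : 'X_{1..t}) : free_of P -> P@_(v + U_(y)) = 0.
Proof.
move=> Py; apply/eqP; apply/negPn/negP => /Py.
by rewrite mnmDE mnm1E eqxx addn1.
Qed.

Lemma mcoeff_mulX_free P (v : 'X_{1..t}) : v y = 0%N -> (P * 'X_y)@_v = 0.
Proof.
move=> vy; apply/eqP; apply/negPn/negP.
rewrite -mcoeff_msupp => /msuppM_le /allpairsP[[v1 v2] /= [_]].
rewrite msuppX inE => /eqP -> vE; move: vy.
by rewrite vE mnmDE mnm1E eqxx addn1.
Qed.

(** The terms divisible by the variable are divided by it; the degree bound survives because the
    variable is not an old one. *)
Lemma free_of_split d P : deg_lt d P ->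
  exists P1 P0, [/\ P = P1 * 'X_y + P0, deg_lt d P1, deg_lt d P0 & free_of P0].
Proof.
move=> Pd; exists (\sum_(v <- msupp P | v y != 0%N) P@_v *: 'X_[v - U_(y)]).
exists (\sum_(v <- msupp P | v y == 0%N) P@_v *: 'X_[v]); split.
- rewrite {1}(mpolyE P) (bigID (fun v : 'X_{1..t} => v y != 0%N)) /=;
  congr (_ + _).
    rewrite mulr_suml; apply: eq_bigr => v; rewrite -lep1mP => le_v.
    by rewrite -scalerAl -mpolyXD submK.
  by apply: eq_bigl => v; rewrite negbK.
- by apply: deg_lt_sum => v _; rewrite -[d]addn0; apply: deg_ltZ => //;
  apply: deg_ltX.
- by apply: deg_lt_sum => v _; rewrite -[d]addn0; apply: deg_ltZ => //;
  apply: deg_ltX.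
- move=> w; rewrite raddf_sum /=; apply: contraNeq => wy.
  by rewrite big1 // => v /eqP vy; rewrite mcoeffZ mcoeffX; case: eqP => [vw|];
     rewrite ?mulr0 // -vw vy in wy *.
Qed.

End FreeOf.

(** * The reduction argument *)

Section Reduction.
Variables (k : fieldType) (r t m n E : nat).
Local Notation R := {mpoly k[r]}.
Local Notation RT := {mpoly {mpoly k[r]}[t]}.
Variables (Delta : 'I_m -> R) (phi : 'M[R]_(m, n)) (e : 'I_n -> nat).
Hypothesis Delta_homog : forall i, Delta i \is E.-homog.
Hypothesis phi_homog : forall i j, phi i j \is (e j).-homog.
Hypothesis exact_phi : forall v : 'I_m -> R,
  \sum_i Delta i * v i = 0 ->
  exists w : 'I_n -> R, forall i, v i = \sum_j phi i j * w j.

(** The component of degree N - e j of an arbitrary w j still works. If e j > N, the truncated bound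
    [N.+1 - e j] is 0 and forces w j = 0. *)
Lemma homog_syzygy N (v : 'I_m -> R) :
    (forall i, v i \is N.-homog) -> \sum_i Delta i * v i = 0 ->
  exists w : 'I_n -> R, (forall i, v i = \sum_j phi i j * w j) /\
    forall j, (msize (w j) <= N.+1 - e j)%N.
Proof.
move=> vN /exact_phi[w vE].
exists (fun j => if (e j <= N)%N then pihomog mdeg (N - e j) (w j) else 0).
split=> [i|j].
  rewrite -(pihomog_dE (vN i)) vE raddf_sum; apply: eq_bigr => j _ /=.
  by rewrite (pihomogM _ _ (phi_homog i j)); case: ifP; rewrite ?mulr0.
case: (leqP (e j) N) => le_eN; last by rewrite msize0.
by rewrite subSn //; apply/msize_homog/pihomogP.
Qed.

(** The previous lemma is applied to the coefficient of each new monomial; a common bound d leaves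
    finitely many choices. *)
Lemma homog_syzygy_ext N (v : 'I_m -> RT) :
    (forall i a, (v i)@_a \is N.-homog) -> \sum_i Delta i *: v i = 0 ->
  exists w : 'I_n -> RT, (forall i, v i = \sum_j phi i j *: w j) /\
    forall j, deg_lt (N.+1 - e j) (w j).
Proof.
move=> vN v0.
have [d le_d] : exists d, forall i, (msize (v i) <= d)%N.
  by exists (\max_i msize (v i))%N => i; apply: leq_bigmax.
have /fin_all_exists[W /all_and2 [WE Wd]] (a : 'X_{1..t < d}) :
    exists w : 'I_n -> R, (forall i, (v i)@_a = \sum_j phi i j * w j) /\
      forall j, (msize (w j) <= N.+1 - e j)%N.
  apply: homog_syzygy => [i|]; first exact: vN.
  have /(congr1 (mcoeff a)) := v0; rewrite mcoeff0 raddf_sum /= => v0a.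
  by apply: etrans v0a; apply: eq_bigr => i _; rewrite mcoeffZ.
exists (fun j => \sum_(a : 'X_{1..t < d}) W a j *: 'X_[a]); split=> [i|j].
  rewrite [LHS](mpolywE (le_d i)).
  under [RHS]eq_bigr do rewrite scaler_sumr.
  rewrite exchange_big; apply: eq_bigr => a _ /=.
  by rewrite WE scaler_suml; apply: eq_bigr => j _; rewrite scalerA.
by apply: deg_lt_sum => a _; rewrite -[(_ - _)%N]addn0; apply: deg_ltZ => //;
  apply: deg_ltX.
Qed.

Variables (ltR : rel 'X_{1..r}) (ltT : rel 'X_{1..t}).
Hypotheses (ltR_mo : monomial_order ltR) (ltT_mo : monomial_order ltT).
Hypothesis ltR_deg : respects_total_degree ltR.
Hypothesis Delta_lead : forall (c : 'I_m -> R) u,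
  is_lead ltR (\sum_i Delta i * c i) u ->
  exists i u', is_lead ltR (Delta i) u' /\ (u' <= u)%MM.

(** [M i] and [D] stand for the signed minors of Phi omitting row i and the last row, [y] for the
    index of Y_{m+1}, [Y] and [Z] for the other new variables, and [L i] for the part of [M i] of
    x-degree below E. *)
Variables (y : 'I_t) (M L Y : 'I_m -> RT) (D : RT) (Z : 'I_n -> RT).
Hypothesis M_top : forall i, M i = Delta i *: 'X_y + L i.
Hypothesis L_deg : forall i, deg_lt E (L i).
Hypothesis D_neq0 : D != 0.
Hypothesis D_homog : forall v, D@_v \is E.-homog.
Hypothesis D_free : free_of y D.
Hypothesis Y_deg : forall i, deg_lt 1 (Y i).
Hypothesis Z_deg : forall j, deg_lt 1 (Z j).
Hypothesis e_gt0 : forall j, (0 < e j)%N.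
Hypothesis col_syz : forall j, \sum_i phi i j *: M i = - (Z j * D).
Hypothesis last_syz : D * 'X_y = - \sum_i Y i * M i.

Definition lead_divides u v :=
  (exists i u' v', [/\ is_block_lead ltR ltT (M i) u' v',
                       (u' <= u)%MM & (v' <= v)%MM]) \/
  (exists u' v', [/\ is_block_lead ltR ltT D u' v',
                     (u' <= u)%MM & (v' <= v)%MM]).

Lemma lead_M i u : is_lead ltR (Delta i) u ->
  is_block_lead ltR ltT (M i) u U_(y).
Proof.
move=> [Du maxu]; rewrite M_top.
apply: (is_block_leadD_deg_lt ltR_deg (d := E)) => // [v|].
  by rewrite mcoeffZ mcoeffX; case: (_ == v); rewrite ?mulr1 ?mulr0 ?dhomog0.
split=> [|u' v']; first by rewrite mcoeffZ mcoeffX eqxx mulr1.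
rewrite mcoeffZ mcoeffX; case: (eqVneq U_(y)%MM v') => [<-|_];
  last by rewrite mulr0 mcoeff0 eqxx.
by rewrite mulr1 => /maxu[->|]; [constructor 1 | constructor 2].
Qed.

(** Only the first summand involves Y_{m+1}, so the exponent of [y] in v tells which summand has the
    lead. *)
Lemma lead_divides_top (A : 'I_m -> RT) B u v :
    free_of y B ->
    is_block_lead ltR ltT ((\sum_i Delta i *: A i) * 'X_y + B * D) u v ->
  lead_divides u v.
Proof.
set Q := \sum_i _; move=> By [nz maxuv].
have BDy : free_of y (B * D) by apply: free_ofM.
have [vy|vy] := eqVneq (v y) 0%N.
  right.
  have : is_block_lead ltR ltT (B * D) u v.
    split=> [|u' v' nz'].
      by move: nz; rewrite mcoeffD mcoeff_mulX_free // add0r.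
    apply: maxuv; rewrite mcoeffD mcoeff_mulX_free ?add0r //; apply: BDy.
    by apply: contraNneq nz' => ->; rewrite mcoeff0.
  case/(is_block_leadM ltR_mo ltT_mo) => u1 [u2 [v1 [v2 [_ lead2 -> ->]]]].
  by exists u2, v2; split=> //; apply: lem_addl.
left.
(* Now u leads the coefficient of v divided by Y_{m+1}, which is a combination of the [Delta i]. *)
have vE : v = (v - U_(y) + U_(y))%MM by rewrite submK // lep1mP.
set v0 := (v - U_(y))%MM in vE.
have coefE v' : ((Q * 'X_y) + B * D)@_(v' + U_(y)) = Q@_v'.
  by rewrite mcoeffD (mcoeff_free_of _ BDy) addr0 addmC mcoeffMX.
have /Delta_lead[i [u' [leadu' le_u]]] :
    is_lead ltR (\sum_i Delta i * (A i)@_v0) u.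
  have -> : \sum_i Delta i * (A i)@_v0 = Q@_v0.
    by rewrite [RHS]raddf_sum; apply: eq_bigr => i _; rewrite /= mcoeffZ.
  split=> [|u' nz']; first by rewrite -coefE -vE.
  have := maxuv u' v; rewrite {1}vE coefE => /(_ nz').
  case=> [[-> _]|lt|[-> _]]; [by left | by right | by left].
exists i, u', U_(y)%MM; split=> //; first exact: lead_M.
by rewrite lep1mP.
Qed.

Lemma lead_divides_comb N (A : 'I_m -> RT) B u v :
    (forall i, deg_lt N (A i)) -> deg_lt N B ->
    is_block_lead ltR ltT (\sum_i A i * M i + B * D) u v ->
  lead_divides u v.
Proof.
have D_deg : deg_lt E.+1 D by move=> w; apply/msize_homog/D_homog.
have M_deg i : deg_lt E.+1 (M i).
  rewrite M_top; apply: deg_ltD; last exact/(deg_ltW _ (L_deg i)).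
  by rewrite -[E.+1]addn0; apply: deg_ltZ (msize_homog _) (@deg_ltX _ _ _ _).
elim: N A B => [|N IH] A B.
  (* At N = 0 all coefficients vanish, and the zero polynomial has no lead. *)
  move=> A0 /deg_lt0 -> [+ _].
  by rewrite big1 => [|i _]; rewrite ?(deg_lt0 (A0 i)) mul0r ?add0r ?mcoeff0
    ?eqxx.
(* With B = B1 Y_{m+1} + B0, the last column trades B1 Y_{m+1} D for a combination of the [M i]; the
   factors [Y i] have x-degree 0, so the bound [N.+1] survives. *)
wlog By : A B / free_of y B.
  move=> wlogB AN /(free_of_split y)[B1 [B0 [-> B1N B0N B0y]]].
  rewrite mulrDl -mulrA ['X_y * _]mulrC last_syz mulrN addrA -mulNr mulr_sumr
    -big_split /=.
  have -> : \sum_i (A i * M i + - B1 * (Y i * M i)) =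
      \sum_i (A i - B1 * Y i) * M i.
    by apply: eq_bigr => i _; rewrite mulrDl mulrA mulNr.
  apply: wlogB => // i; apply: deg_ltD => //.
  by apply: deg_ltN; rewrite -[N.+1]addn0; apply: deg_ltM.
move=> AN BN.
pose A' i := homog_part N (A i); pose B' := homog_part N B.
have A'N i w : (A' i)@_w \is N.-homog by rewrite mcoeff_homog_part pihomogP.
have B'N w : B'@_w \is N.-homog by rewrite mcoeff_homog_part pihomogP.
have B'y : free_of y B'.
  move=> w; rewrite mcoeff_homog_part => nz; apply: By.
  by apply: contraNneq nz => ->; rewrite pihomog0.
pose Q := \sum_i Delta i *: A' i.
pose P' := Q * 'X_y + B' * D.
have P'_homog w : P'@_w \is (N + E).-homog.
  rewrite mcoeffD rpredD //; last exact: mcoeff_homogM.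
  rewrite -[(N + E)%N]addn0.
  apply: mcoeff_homogM => {}w.
    rewrite raddf_sum rpred_sum //= => i _.
    by rewrite mcoeffZ addnC dhomogM.
  by rewrite mcoeffX; case: (_ == w); rewrite ?dhomog1 ?dhomog0.
(* [Q'] collects what has x-degree below N + E. *)
pose Q' := \sum_i (A i - A' i) * M i + \sum_i A' i * L i + (B - B') * D.
have Q'_deg : deg_lt (N + E) Q'.
  apply: deg_ltD; last by apply: deg_ltM => //; apply: deg_lt_sub_homog_part.
  apply: deg_ltD; apply: deg_lt_sum => i _.
    by apply: deg_ltM => //; apply: deg_lt_sub_homog_part.
  by rewrite mulrC addnC; apply: deg_ltM => // w; apply: msize_homog.
have A'M i : A' i * M i = (Delta i *: A' i) * 'X_y + A' i * L i.
  by rewrite M_top mulrDr -scalerAr -scalerAl.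
have AME : \sum_i A i * M i =
    Q * 'X_y + (\sum_i (A i - A' i) * M i + \sum_i A' i * L i).
  rewrite mulr_suml -!big_split; apply: eq_bigr => i _ /=.
  by rewrite addrCA -A'M -mulrDl subrK.
have -> : \sum_i A i * M i + B * D = P' + Q'.
  by rewrite AME [RHS]addrACA -mulrDl [B' + _]addrC subrK.
have [P'0|P'0] := eqVneq P' 0; last first.
  by move/(is_block_lead_top ltR_mo ltR_deg P'_homog P'0
    Q'_deg)/lead_divides_top; apply.
(* [B' * D] is free of Y_{m+1}, so at multiples of Y_{m+1} the coefficients of [P'] are those of
   [Q]. *)
have Q0 : Q = 0.
  apply/mpolyP => w; have /(congr1 (mcoeff (w + U_(y))%MM)) := P'0.
  rewrite mcoeffD (mcoeff_free_of _ (free_ofM B'y D_free)) addr0.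
  by rewrite addmC mcoeffMX !mcoeff0.
have B'0 : B' = 0.
  have B'D : B' * D = 0 by move: P'0; rewrite /P' Q0 mul0r add0r.
  by have /orP[/eqP//|] := mpoly_idomainAxiom B'D; rewrite (negbTE D_neq0).
have [w [A'E wN]] := homog_syzygy_ext A'N Q0.
rewrite P'0 add0r.
(* As [Q] is 0, the sum of the [A' i * L i] equals that of the [A' i * M i], which the column
   syzygies turn into a multiple of [D]. *)
have -> : Q' = \sum_i (A i - A' i) * M i + (B - \sum_j w j * Z j) * D.
  rewrite /Q' B'0 subr0 mulrBl -addrA; congr (_ + _).
  rewrite addrC; congr (_ + _); transitivity (\sum_i A' i * M i).
    under [RHS]eq_bigr do rewrite A'M.
    by rewrite big_split -mulr_suml /= -/Q Q0 mul0r add0r.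
  under eq_bigr do rewrite A'E mulr_suml.
  rewrite exchange_big mulr_suml -sumrN; apply: eq_bigr => j _ /=.
  rewrite -mulrA -mulrN -col_syz mulr_sumr; apply: eq_bigr => i _.
  by rewrite -scalerAl -scalerAr.
apply: IH => [i|]; first exact: deg_lt_sub_homog_part.
apply: deg_ltD; first by rewrite -[B]subr0 -B'0; apply: deg_lt_sub_homog_part.
apply/deg_ltN/deg_lt_sum => j _; rewrite -[N]addn0; apply: deg_ltM => //.
(* Here 0 < e j enters: [N.+1 - e j] is at most N. *)
by apply: deg_ltW (wN j); rewrite leq_subLR -addn1 addnC leq_add2r.
Qed.

End Reduction.

(** * A divisibility criterion for Gröbner bases *)

Section GroebnerCriterion.
Variables (k : fieldType) (n : nat) (lt : rel 'X_{1..n}).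
Hypothesis lt_mo : monomial_order lt.
Variables (I : {mpoly k[n]} -> Prop) (G : seq {mpoly k[n]}).

(** A monomial occurring in a combination of terms is divisible by one of them. *)
Lemma initial_ideal_lead p : p != 0 ->
    initial_ideal lt (fun g => g \in G) (in_term lt p) ->
  exists g, [/\ g \in G, g != 0 & (lead_mono lt g <= lead_mono lt p)%MM].
Proof.
move=> p0 [l [c [g [Gg tE]]]].
have : (in_term lt p)@_(lead_mono lt p) != 0.
  by rewrite mcoeffZ mcoeffX eqxx mulr1; case: (is_lead_lead_mono lt_mo p0).
rewrite tE raddf_sum /= => nz.
have [i nzi] : exists i, (c i * g i)@_(lead_mono lt p) != 0.
  apply/existsP; apply: contraNT nz; rewrite negb_exists => /forallP z.
  by rewrite big1 // => i _; have := z i; rewrite negbK => /eqP.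
have [q [Gq q0 gE]] := Gg i; exists q; split=> //.
move: nzi; rewrite gE /in_term -scalerAr mcoeffZ mulf_eq0 negb_or => /andP[_].
rewrite -mcoeff_msupp => /msuppM_le /allpairsP[[a b] /= [_]].
by rewrite msuppX inE => /eqP -> ->; apply: lem_addl.
Qed.

Lemma groebner_basisP :
    (forall g, g \in G -> I g) ->
    (forall p, I p -> p != 0 ->
      exists g, [/\ g \in G, g != 0 & (lead_mono lt g <= lead_mono lt p)%MM]) ->
  groebner_basis lt I G.
Proof.
move=> GI leadG; split=> // x; split; apply: ideal_gen_sub;
  do ?exact: ideal_gen_is_ideal; move=> _ [p [Ip p0 ->]].
  have [g [Gg g0 le_gp]] := leadG _ Ip p0.
  have [gc0 _] := is_lead_lead_mono lt_mo g0.
  have -> : in_term lt p = (p@_(lead_mono lt p) / g@_(lead_mono lt g)) *: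
      'X_[lead_mono lt p - lead_mono lt g] * in_term lt g.
    rewrite /in_term -scalerAl -scalerAr scalerA -mpolyXD submK //.
    by rewrite divfK.
  have [_ _] := ideal_gen_is_ideal (fun t => exists q,
    [/\ q \in G, q != 0 & t = in_term lt q]).
  by apply; apply: mem_ideal_gen; exists g.
by apply: mem_ideal_gen; exists p; split=> //; apply: GI.
Qed.

End GroebnerCriterion.

(** * Degrees of determinants *)

Section HomogeneousMinors.
Variables (k : fieldType) (r t : nat).

Lemma det_homog q (M : 'M[{mpoly k[r]}]_q) (e : 'I_q -> nat) :
    (forall i j, M i j \is (e j).-homog) ->
  \det M \is (\sum_j e j).-homog.
Proof.
move=> Me; apply: rpred_sum => s _; rewrite mulr_sign.
have H : \prod_i M i (s i) \is (\sum_j e j).-homog.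
  (* Each Leibniz term meets every column exactly once. *)
  have -> : (\sum_j e j = \sum_j e (s j))%N by apply/reindex_inj/perm_inj.
  apply: (big_rec2 (fun p d => p \is d.-homog)) => [|i p d _ IH].
    exact: dhomog1.
  exact: dhomogM.
by case: (odd_perm s); rewrite ?rpredN.
Qed.

Lemma deg_lt_prod (J : Type) (s : seq J) (B : pred J) (c : J -> nat)
    (F : J -> {mpoly {mpoly k[r]}[t]}) :
    (forall i, deg_lt (c i).+1 (F i)) ->
  deg_lt (\sum_(i <- s | B i) c i).+1 (\prod_(i <- s | B i) F i).
Proof.
move=> Fc; apply: (big_rec2 (fun P d => deg_lt d.+1 P)) => [|i P d _ IH].
  by rewrite -mpolyX0; apply: deg_ltX.
by rewrite -addSn; apply: deg_ltM.
Qed.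

(* One row below its degree bound suffices, as every term of the Leibniz     *)
(* formula meets it.                                                         *)
Lemma deg_lt_det q (M : 'M[{mpoly {mpoly k[r]}[t]}]_q) (c : 'I_q -> nat) i0 :
    (forall i j, deg_lt (c j).+1 (M i j)) ->
    (forall j, deg_lt (c j) (M i0 j)) ->
  deg_lt (\sum_j c j) (\det M).
Proof.
move=> Mc M0; apply: deg_lt_sum => s _; rewrite mulr_sign.
have H : deg_lt (\sum_j c j) (\prod_i M i (s i)).
  have -> : (\sum_j c j = \sum_j c (s j))%N by apply/reindex_inj/perm_inj.
  rewrite (bigD1 i0) // [X in deg_lt _ X](bigD1 i0) //=.
  by apply: deg_ltM => //; apply: deg_lt_prod.
by case: (odd_perm s) => //; apply: deg_ltN.
Qed.

Lemma deg_lt_fin (J : finType) (F : J -> {mpoly {mpoly k[r]}[t]}) :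
  exists d, forall i, deg_lt d (F i).
Proof.
exists (\max_i \max_(v <- msupp (F i)) msize (F i)@_v)%N => i v.
apply: leq_trans (leq_bigmax i).
have [vF|/memN_msupp_eq0 ->] := boolP (v \in msupp (F i));
  last by rewrite msize0.
exact: leq_bigmax_seq.
Qed.

End HomogeneousMinors.

Lemma bump_max n (i : 'I_n) : bump n i = i.
Proof. by rewrite /bump leqNgt ltn_ord. Qed.

Lemma widen_ord_max n (i : 'I_n) : widen_ord (leqnSn n) i = lift ord_max i.
Proof. by apply: val_inj; rewrite /= bump_max. Qed.

Lemma lift_lift_max n (i : 'I_n.+1) (x : 'I_n) :
  lift (lift ord_max i) (lift ord_max x) = lift ord_max (lift i x).
Proof. by apply: val_inj; rewrite /= !bump_max (bump_max (lift i x)). Qed.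

Lemma lift_lift_ord_max n (i : 'I_n.+1) :
  lift (lift ord_max i) ord_max = ord_max :> 'I_n.+2.
Proof. by apply: val_inj; rewrite /= bump_max /bump -ltnS ltn_ord. Qed.

(** * Minors of the bordered matrix *)

Section BorderedMatrix.
Variables (A : comNzRingType) (n : nat) (B : 'M[A]_(n.+2, n.+1)).
Local Notation top := (row' ord_max (col' ord_max B)).

(** Expansion along the last column. The cofactor sign (-1)^(i+n) times (-1)^(n+1) is minus the sign
    (-1)^i in the minors of [top]. *)
Lemma signed_minor_border_last : signed_minor B ord_max =
  - \sum_i B (lift ord_max i) ord_max * signed_minor top i.
Proof.
rewrite /signed_minor (expand_det_col _ ord_max) mulr_sumr -sumrN.
apply: eq_bigr => i _; rewrite mxE mulrCA -mulrN; congr (_ * _).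
rewrite /cofactor mulrA -exprD -mulNr; congr (_ * _).
  by rewrite /= addnCA addSn addnn exprD exprS -muln2 exprM sqrr_sign; ring.
by congr determinant; apply/matrixP => a b; rewrite !mxE.
Qed.

Lemma signed_minor_border_syzygy j (c : 'I_n.+1 -> A) (d : A) :
    (forall i, B (lift ord_max i) j = c i) -> B ord_max j = d ->
  signed_minor B ord_max * d = - \sum_i c i * signed_minor B (lift ord_max i).
Proof.
move=> Bc Bd; have := signed_minor_syzygy B j.
rewrite big_ord_recr /= Bd addrC mulrC => /eqP; rewrite addr_eq0 => /eqP ->.
by congr (- _); apply: eq_bigr => i _; rewrite widen_ord_max Bc.
Qed.

(* The matrix of the i-th minor with its corner entry Y_(m+1) replaced by 0. *)
Definition uncornered i : 'M_n.+1 := \matrix_(a, b)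
  if (a == ord_max) && (b == ord_max) then 0 else row' (lift ord_max i) B a b.

(** Expansion along the last row with the corner split off; the corner has cofactor sign (-1)^(n+n)
    = 1. *)
Lemma signed_minor_border_top i : signed_minor B (lift ord_max i) =
  signed_minor top i * B ord_max ord_max + (-1) ^+ i * \det (uncornered i).
Proof.
rewrite /signed_minor lift_max.
rewrite (expand_det_row (uncornered i) ord_max).
rewrite (expand_det_row (row' _ B) ord_max) [in LHS](bigD1 ord_max) //=.
rewrite [in RHS](bigD1 ord_max) //= mulrDr.
rewrite [uncornered i _ _]mxE !eqxx mul0r add0r; congr (_ + _ * _).
  rewrite mxE lift_lift_ord_max mulrCA mulrC; congr (_ * _ * _).
  rewrite /cofactor addnn -muln2 exprM sqrr_sign mul1r; congr determinant.
  by apply/matrixP => a b; rewrite !mxE lift_lift_max.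
apply: eq_bigr => b /negbTE b_max; rewrite [uncornered i _ _]mxE eqxx b_max.
congr (_ * (_ * \det _)); apply/matrixP => a c.
by rewrite !mxE eq_sym (negbTE (neq_lift _ _)).
Qed.

End BorderedMatrix.

(** * Transport of minors, generators and leads *)

Lemma signed_minor_cast (A : comNzRingType) (q1 q2 : nat) (e : q1 = q2)
    (M : 'M[A]_(q2.+1, q2)) i :
  signed_minor (\matrix_(a < q1.+1, b < q1) M (cast_ord (congr1 S e) a)
    (cast_ord e b)) i
    = signed_minor M (cast_ord (congr1 S e) i).
Proof.
subst q2; rewrite cast_ord_id; congr signed_minor.
by apply/matrixP => a b; rewrite mxE !cast_ord_id.
Qed.

Lemma map_signed_minor (A A' : comNzRingType) (g : {rmorphism A -> A'}) q
    (M : 'M[A]_(q.+1, q)) i :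
  signed_minor (map_mx g M) i = g (signed_minor M i).
Proof. by rewrite /signed_minor -map_row' det_map_mx rmorphM rmorphXn rmorphN1.
  Qed.

(** A zero generator could be dropped. *)
Lemma minimal_generators_neq0 (A : comNzRingType) (m : nat) (f : 'I_m -> A)
    (I : A -> Prop) i :
  minimal_generators f I -> f i != 0.
Proof.
move=> [genI minI]; apply/eqP => fi0.
apply: (minI (~: [set i])).
  rewrite properT; apply/negP => /eqP/setP/(_ i).
  by rewrite !inE eqxx.
move=> x; split=> [|/genI].
  move=> gx; apply/genI; apply: ideal_gen_sub gx;
    first exact: ideal_gen_is_ideal.
  by move=> _ [j _ ->]; apply: mem_ideal_gen; apply: codom_f.
apply: ideal_gen_sub; first exact: ideal_gen_is_ideal.
move=> _ /codomP[j ->]; have [->|j_i] := eqVneq j i.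
  by rewrite fi0; case: (ideal_gen_is_ideal (fun x => exists2 i0,
    i0 \in ~: [set i] & x = f i0)).
by apply: mem_ideal_gen; exists j; rewrite // !inE.
Qed.

Lemma codom_ideal_sum (A : comNzRingType) (m : nat) (f c : 'I_m -> A) :
  ideal_seq (codom f) (\sum_i f i * c i).
Proof.
have idf := ideal_gen_is_ideal (fun x => x \in codom f).
apply: ideal_sum => // i _; rewrite mulrC.
by case: idf => _ _; apply; apply/mem_ideal_gen/codom_f.
Qed.

(** For p = sum_i g i * c i, the product h p lies in I, so in(h) in(p) is divisible by some in(f i)
    = in(h) in(g i), and in(h) cancels. *)
Lemma lead_common_factor (k : fieldType) (r m : nat) (lt : rel 'X_{1..r})
    (I : {mpoly k[r]} -> Prop) (f g c : 'I_m -> {mpoly k[r]}) h u :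
    monomial_order lt -> eqideal I (ideal_seq (codom f)) ->
    groebner_basis lt I (codom f) -> h != 0 -> (forall i, f i = h * g i) ->
    is_lead lt (\sum_i g i * c i) u ->
  exists i u', is_lead lt (g i) u' /\ (u' <= u)%MM.
Proof.
move=> mo genI [_ gbI] h0 fE lead_u; set p := \sum_i _ in lead_u.
have lead_h := is_lead_lead_mono mo h0.
have hpE : h * p = \sum_i f i * c i.
  by rewrite mulr_sumr; apply: eq_bigr => i _; rewrite fE mulrA.
have lead_hp := is_leadM mo lead_h lead_u.
have hp0 : h * p != 0.
  by apply: contraTneq lead_hp.1 => ->; rewrite mcoeff0 eqxx.
have : initial_ideal lt I (in_term lt (h * p)).
  apply: mem_ideal_gen; exists (h * p); split=> //.
  by apply/genI; rewrite hpE; apply: codom_ideal_sum.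
case/gbI/(initial_ideal_lead mo hp0) => _ [/codomP[i ->] fi0].
have gi0 : g i != 0 by apply: contraNneq fi0; rewrite fE => ->; rewrite mulr0.
have lead_gi := is_lead_lead_mono mo gi0.
rewrite (lead_monoE mo lead_hp) fE (lead_monoE mo (is_leadM mo lead_h lead_gi)).
move=> /mnm_lepP le; exists i, (lead_mono lt (g i)); split=> //.
by apply/mnm_lepP => j; have := le j; rewrite !mnmDE leq_add2l.
Qed.

Lemma is_lead_signed_minor (k : fieldType) (n q : nat) (lt : rel 'X_{1..n})
    (M : 'M[{mpoly k[n]}]_(q.+1, q)) i w :
  is_lead lt (signed_minor M i) w -> is_lead lt (\det (row' i M)) w.
Proof.
have E u : ((signed_minor M i)@_u != 0) = ((\det (row' i M))@_u != 0).
  by rewrite /signed_minor -signr_odd mulr_sign; case: (odd _) => //;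
    rewrite mcoeffN oppr_eq0.
by move=> [nz maxw]; split=> [|u]; rewrite -E // => /maxw.
Qed.

(** * The bordered matrix over R[Y,Z] *)

Section SplitPhi.
Variables (k : fieldType) (r n : nat) (phi : 'M[{mpoly k[r]}]_(n.+1, n)).
Local Notation t := ((n.+1 + 1) + n)%N.

(* n + 1 is not convertible to n.+1, and ord_max and lift need the latter.   *)
Definition cast_Phi : 'M_(n.+2, n.+1) := \matrix_(a < n.+2, b < n.+1)
  (@Phi_mx k r n.+1 phi) (cast_ord (congr1 S (esym (addn1 n))) a)
    (cast_ord (esym (addn1 n)) b).

Definition Psi : 'M[{mpoly {mpoly k[r]}[t]}]_(n.+2, n.+1) :=
  map_mx (@split_mpoly k r t) cast_Phi.

Let cast_lift m (e : m.+1 = (m + 1)%N) (i : 'I_m) :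
  cast_ord e (lift ord_max i) = lshift 1 i.
Proof. by apply: val_inj; rewrite /= bump_max. Qed.

Let cast_max m (e : m.+1 = (m + 1)%N) : cast_ord e ord_max = rshift m 0.
Proof. by apply: val_inj; rewrite /= addn0. Qed.

Lemma Psi_lift_lift i j : Psi (lift ord_max i) (lift ord_max j) = (phi i j)%:MP.
Proof.
by rewrite mxE [cast_Phi _ _]mxE /Phi_mx (cast_lift _ i) cast_lift block_mxEul
  mxE split_mpoly_lshift.
Qed.

Lemma Psi_lift_max i :
  Psi (lift ord_max i) ord_max = 'X_(lshift n (lshift 1 i)).
Proof.
by rewrite mxE [cast_Phi _ _]mxE /Phi_mx (cast_lift _ i) cast_max block_mxEur
  mxE split_mpoly_rshift.
Qed.

Lemma Psi_max_lift j : Psi ord_max (lift ord_max j) = 'X_(rshift (n.+1 + 1) j).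
Proof.
by rewrite mxE [cast_Phi _ _]mxE /Phi_mx (@cast_max n.+1) cast_lift block_mxEdl
  mxE split_mpoly_rshift.
Qed.

Lemma Psi_max_max : Psi ord_max ord_max = 'X_(lshift n (rshift n.+1 0)).
Proof.
by rewrite mxE [cast_Phi _ _]mxE /Phi_mx (@cast_max n.+1) cast_max block_mxEdr
  mxE split_mpoly_rshift.
Qed.

Lemma signed_minor_top_Psi i :
  signed_minor (row' ord_max (col' ord_max Psi)) i = (signed_minor phi i)%:MP.
Proof.
have -> : row' ord_max (col' ord_max Psi) = map_mx (@mpolyC t {mpoly k[r]}) phi.
  by apply/matrixP => a b; rewrite mxE [LHS]mxE Psi_lift_lift mxE.
exact: (map_signed_minor (@mpolyC t {mpoly k[r]})).
Qed.

Lemma signed_minor_Psi_max : signed_minor Psi ord_max =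
  - \sum_i signed_minor phi i *: 'X_(lshift n (lshift 1 i)).
Proof.
rewrite signed_minor_border_last; congr (- _); apply: eq_bigr => i _.
by rewrite Psi_lift_max signed_minor_top_Psi mulrC mul_mpolyC.
Qed.

Lemma mcoeff_signed_minor_Psi_max v : (signed_minor Psi ord_max)@_v =
  - \sum_i signed_minor phi i * (U_(lshift n (lshift 1 i))%MM == v)%:R.
Proof.
rewrite signed_minor_Psi_max mcoeffN raddf_sum; congr (- _).
by apply: eq_bigr => i _; rewrite /= mcoeffZ mcoeffX.
Qed.

Lemma mcoeff_signed_minor_Psi_max_U i :
  (signed_minor Psi ord_max)@_U_(lshift n (lshift 1 i)) = - signed_minor phi i.
Proof.
rewrite mcoeff_signed_minor_Psi_max; move: (signed_minor phi) => Delta.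
rewrite (bigD1 i) //= eqxx mulr1 big1 ?addr0 // => j /negbTE j_i.
by rewrite eq_mnm1 !eq_lshift j_i mulr0.
Qed.

Lemma signed_minor_Psi_lift i : signed_minor Psi (lift ord_max i) =
  signed_minor phi i *: 'X_(lshift n (rshift n.+1 0)) +
  (-1) ^+ i * \det (uncornered Psi i).
Proof.
by rewrite signed_minor_border_top Psi_max_max signed_minor_top_Psi mul_mpolyC.
Qed.

Lemma Psi_col_syzygy j :
  \sum_i phi i j *: signed_minor Psi (lift ord_max i) =
    - ('X_(rshift (n.+1 + 1) j) * signed_minor Psi ord_max).
Proof.
have := signed_minor_syzygy Psi (lift ord_max j); rewrite big_ord_recr /=.
rewrite Psi_max_lift => /eqP; rewrite addr_eq0 => /eqP <-.
apply: eq_bigr => i _.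
by rewrite widen_ord_max Psi_lift_lift mul_mpolyC.
Qed.

Lemma Psi_last_syzygy :
  signed_minor Psi ord_max * 'X_(lshift n (rshift n.+1 0)) =
    - \sum_i 'X_(lshift n (lshift 1 i)) * signed_minor Psi (lift ord_max i).
Proof.
exact: (signed_minor_border_syzygy Psi_lift_max Psi_max_max).
Qed.

Variable e : 'I_n -> nat.
Hypothesis phi_homog : forall i j, phi i j \is (e j).-homog.
Hypothesis e_gt0 : forall j, (0 < e j)%N.

Lemma signed_minor_phi_homog i : signed_minor phi i \is (\sum_j e j).-homog.
Proof.
rewrite /signed_minor -signr_odd mulr_sign.
have H : \det (row' i phi) \is (\sum_j e j).-homog.
  by apply: det_homog => a b; rewrite mxE.
by case: (odd i); rewrite ?rpredN.
Qed.

Lemma signed_minor_Psi_max_homog v :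
  (signed_minor Psi ord_max)@_v \is (\sum_j e j).-homog.
Proof.
rewrite mcoeff_signed_minor_Psi_max rpredN rpred_sum // => i _.
by case: (_ == v); rewrite ?mulr1 ?mulr0 ?dhomog0 ?signed_minor_phi_homog.
Qed.

(** The columns of [phi] get the bound e j and the last column the bound 0. In the last row each Z_j
    has x-degree 0 < e j, and the corner has to be 0 because nothing else has degree below 0. *)
Lemma deg_lt_uncornered (i : 'I_n.+1) :
  deg_lt (\sum_j e j) ((-1) ^+ i * \det (uncornered Psi i)).
Proof.
pose c (b : 'I_n.+1) := oapp e 0%N (unlift ord_max b).
have H : deg_lt (\sum_j e j) (\det (uncornered Psi i)).
  have -> : (\sum_j e j = \sum_b c b)%N.
    rewrite big_ord_recr /= {2}/c unlift_none addn0; apply: eq_bigr => j _.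
    by rewrite widen_ord_max /c liftK.
  apply: (deg_lt_det (i0 := ord_max)) => [a b|b];
    rewrite /c [uncornered _ _ _ _]mxE.
    case: ifP => _; first exact: deg_lt_zero.
    rewrite mxE; case: (unliftP ord_max a) => [a' ->|->];
      rewrite ?lift_lift_max ?lift_lift_ord_max;
    case: (unliftP ord_max b) => [b' ->|->] /=.
    - rewrite Psi_lift_lift => v; rewrite mcoeffC.
      by case: (v == _); rewrite ?mulr1 ?mulr0 ?msize0 ?msize_homog.
    - by rewrite Psi_lift_max; apply: deg_ltX.
    - by rewrite Psi_max_lift; apply: deg_ltW (@deg_ltX _ _ _ _).
    - by rewrite Psi_max_max; apply: deg_ltX.
  rewrite eqxx; case: (unliftP ord_max b) => [b' ->|->] /=; last first.
    by rewrite eqxx; apply: deg_lt_zero.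
  rewrite eq_sym (negbTE (neq_lift _ _)) mxE lift_lift_ord_max Psi_max_lift.
  by apply: deg_ltW (@deg_ltX _ _ _ _).
by rewrite -signr_odd mulr_sign; case: (odd i) => //; apply: deg_ltN.
Qed.

End SplitPhi.

(** * Assembling the Gröbner basis *)

Lemma split_mpoly_sum_recr (k : fieldType) (r t n : nat)
    (c s : 'I_n.+1 -> {mpoly k[r + t]})
    (s' : 'I_n.+1 -> {mpoly {mpoly k[r]}[t]}) :
    (forall i, split_mpoly (s i) = s' i) ->
  split_mpoly (\sum_i c i * s i) =
    \sum_i split_mpoly (c (lift ord_max i)) * s' (lift ord_max i) +
      split_mpoly (c ord_max) * s' ord_max.
Proof.
move=> ss'; rewrite (raddf_sum (@split_mpoly k r t)) big_ord_recr;
  congr (_ + _).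
  by apply: eq_bigr => i _; rewrite widen_ord_max -ss' -(rmorphM (@split_mpoly
    k r t)).
by rewrite -ss' -(rmorphM (@split_mpoly k r t)).
Qed.

Lemma Phi_mx_groebner (k : fieldType) (r n d : nat)
    (ltR : rel 'X_{1..r}) (hltR : monomial_order ltR)
    (hdeg : respects_total_degree ltR)
    (I : {mpoly k[r]} -> Prop) (f : 'I_n.+1 -> {mpoly k[r]})
    (hI : eqideal I (ideal_seq (codom f)))
    (hfGB : groebner_basis ltR I (codom f))
    (hfmin : minimal_generators f I)
    (b : 'I_n -> nat) (phi : 'M[{mpoly k[r]}]_(n.+1, n))
    (hphi : graded_free_presentation f (fun=> d) b phi)
    (e : 'I_n -> nat)
    (he : forall i j, phi i j != 0 -> phi i j \is (e j).-homog)
    (ltT : rel 'X_{1..((n.+1 + 1) + n)}) (hltT : monomial_order ltT) :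
  groebner_basis (inverse_block_order ltR ltT)
    (ideal_seq (minors n.+1 (@Phi_mx k r n.+1 phi)))
    (minors n.+1 (@Phi_mx k r n.+1 phi)).
Proof.
have phi_homog i j : phi i j \is (e j).-homog.
  by have [->|/he//] := eqVneq (phi i j) 0; rewrite dhomog0.
have phi_inj := gfp_inj hphi.
have [h fE] := hilbert_burch phi_inj (gfp_exact hphi).
have h0 : h != 0.
  have := minimal_generators_neq0 ord0 hfmin; rewrite fE.
  by apply: contraNneq => ->; rewrite mul0r.
(* A column of degree 0 would consist of constants, which are 0 in a minimal presentation; then
   [phi] would kill a unit vector. *)
have e_gt0 j : (0 < e j)%N.
  rewrite lt0n; apply/eqP => ej0.
  have /eqP/matrixP/(_ j 0) : delta_mx j 0 == 0 :> 'cV[{mpoly k[r]}]_n.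
    apply/eqP/phi_inj; rewrite -colE; apply/matrixP => i ?; rewrite !mxE.
    have : (msize (phi i j) <= 1)%N by rewrite -ej0 msize_homog.
    by move/msize1_polyC ->; rewrite (gfp_minimal hphi) mpolyC0.
  by rewrite !mxE !eqxx => /eqP; rewrite oner_eq0.
have exact_phi (v : 'I_n.+1 -> {mpoly k[r]}) :
    \sum_i signed_minor phi i * v i = 0 ->
    exists w : 'I_n -> {mpoly k[r]}, forall i, v i = \sum_j phi i j * w j.
  move=> v0; have [w vE] : exists w : 'cV_n, \col_i v i = phi *m w.
    apply/(gfp_exact hphi); transitivity (h * \sum_i signed_minor phi i * v i).
      by rewrite mulr_sumr; apply: eq_bigr => i _; rewrite mxE fE -mulrA.
    by rewrite v0 mulr0.
  exists (fun j => w j 0) => i.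
  by have /matrixP/(_ i 0) := vE; rewrite !mxE.
have Delta_lead := lead_common_factor hltR hI hfGB h0 fE.
pose y : 'I_((n.+1 + 1) + n) := lshift n (rshift n.+1 0).
(* Up to sign, the signed minors of [phi] are coefficients of this minor, and one of them is
   nonzero. *)
have D0 : signed_minor (Psi phi) ord_max != 0.
  have [i Di0] := signed_minor_neq0 phi_inj.
  apply: contraNneq Di0 => D0.
  by rewrite -oppr_eq0 -mcoeff_signed_minor_Psi_max_U D0 mcoeff0.
have D_free : free_of y (signed_minor (Psi phi) ord_max).
  move=> v; rewrite mcoeff_signed_minor_Psi_max oppr_eq0 => nz.
  apply/eqP; apply: contraNT nz => vy; rewrite big1 // => i _.
  case: eqP => [vE|]; rewrite ?mulr0 //.
  by rewrite -vE mnm1E eq_lshift eq_lrshift in vy.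
have core := lead_divides_comb (signed_minor_phi_homog phi_homog) phi_homog
  exact_phi
  hltR hltT hdeg Delta_lead (signed_minor_Psi_lift phi)
  (deg_lt_uncornered phi_homog e_gt0) D0 (signed_minor_Psi_max_homog phi_homog)
  D_free (fun i => @deg_ltX _ _ _ _) (fun j => @deg_ltX _ _ _ _) e_gt0
  (Psi_col_syzygy phi) (Psi_last_syzygy phi).
set Phi := Phi_mx phi in core *.
have mo := inverse_block_order_mo hltR hltT.
apply: (groebner_basisP mo) => [g Gg|p]; first exact: (@mem_ideal_gen _ (fun x
  => x \in _)).
move=> Jp p0.
have [c pE] : exists c, p = \sum_i c i * signed_minor (cast_Phi phi) i.
  pose N p := exists c, p = \sum_i c i * signed_minor (cast_Phi phi) i.
  apply: (@ideal_gen_sub _ _ N p _ _ Jp).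
    split=> [|x1 x2 [c1 ->] [c2 ->]|a x1 [c1 ->]].
    - by exists (fun=> 0); rewrite big1 // => i _; rewrite mul0r.
    - exists (fun i => c1 i + c2 i); rewrite -big_split.
      by apply: eq_bigr => i _; rewrite mulrDl.
    - exists (fun i => a * c1 i); rewrite mulr_sumr.
      by apply: eq_bigr => i _; rewrite mulrA.
  move=> x /(maximal_minor_signed_minor (esym (addn1 n)))[i [a ->]].
  pose i' := cast_ord (congr1 S (addn1 n)) i.
  exists (fun l => if l == i' then a else 0).
  rewrite (bigD1 i') //= eqxx big1 ?addr0 => [|l /negbTE ->];
    last by rewrite mul0r.
  rewrite (signed_minor_cast (esym (addn1 n))); congr (_ * signed_minor _ _).
  by apply: val_inj.
have smE i :
    split_mpoly (signed_minor (cast_Phi phi) i) = signed_minor (Psi phi) i.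
  exact: esym (map_signed_minor _ _ _).
have [N cN] := deg_lt_fin (fun i => split_mpoly (c i)).
have splitE := split_mpoly_sum_recr c smE; rewrite -pE in splitE.
have /is_lead_split lead_p := is_lead_lead_mono mo p0.
rewrite splitE in lead_p.
(* Leads found over R[Y,Z] are carried back to k[x,Y,Z]; the sign of a minor does not affect its
   lead. *)
have divides_lead i u v :
    is_block_lead ltR ltT (signed_minor (Psi phi) i) u v ->
    (u <= lmnm (lead_mono (inverse_block_order ltR ltT) p))%MM ->
    (v <= rmnm (lead_mono (inverse_block_order ltR ltT) p))%MM ->
  exists g, [/\ g \in minors n.+1 Phi, g != 0 &
    (lead_mono (inverse_block_order ltR ltT) g <=
       lead_mono (inverse_block_order ltR ltT) p)%MM].
  rewrite -smE -[u in is_block_lead _ _ _ u](lmnm_cat u v).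
  rewrite -[v in is_block_lead _ _ _ _ v](rmnm_cat u v) => /is_lead_split.
  rewrite (signed_minor_cast (esym (addn1 n))) =>
    /is_lead_signed_minor lead_g le_u le_v.
  exists (\det (row' (cast_ord (congr1 S (esym (addn1 n))) i) Phi)); split.
  - exact: det_row'_minors (esym (addn1 n)).
  - by apply: contraTneq lead_g.1 => ->; rewrite mcoeff0 eqxx.
  - by rewrite (lead_monoE mo lead_g); apply: le_block_mnm;
    rewrite ?lmnm_cat ?rmnm_cat.
have [[i [u [v []]]]|[u [v []]]] :=
  core N _ _ _ _ (fun i => cN _) (cN _) lead_p; exact: divides_lead.
Qed.

Theorem theorem2p2 (k : fieldType) (r m d : nat)
    (ltR : rel 'X_{1..r}) (hltR : monomial_order ltR)
    (hdeg : respects_total_degree ltR)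
    (I : {mpoly k[r]} -> Prop) (f : 'I_m -> {mpoly k[r]})
    (hI : eqideal I (ideal_seq (codom f)))
    (hcodim : codim_is I 2)
    (hCM : cohen_macaulay_quotient I)
    (hIhomog : homogeneous_ideal I)
    (hfhomog : forall i, f i \is d.-homog)
    (hfGB : groebner_basis ltR I (codom f))
    (hfmin : minimal_generators f I)
    (b : 'I_m.-1 -> nat) (phi : 'M[{mpoly k[r]}]_(m, m.-1))
    (hphi : graded_free_presentation f (fun=> d) b phi)
    (e : 'I_m.-1 -> nat)
    (he : forall i j, phi i j != 0 -> phi i j \is (e j).-homog)
    (degYZ : 'I_((m + 1) + m.-1) -> nat)
    (hdegY : forall i : 'I_(m + 1), degYZ (lshift m.-1 i) = 1%N)
    (hdegZ : forall j : 'I_m.-1, degYZ (rshift (m + 1) j) = e j)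
    (ltT : rel 'X_{1..((m + 1) + m.-1)}) (hltT : monomial_order ltT) :
  groebner_basis (inverse_block_order ltR ltT)
    (ideal_seq (minors m (Phi_mx phi))) (minors m (Phi_mx phi)).
Proof.
case: m f hI hfhomog hfGB hfmin b phi hphi e he degYZ hdegY hdegZ ltT hltT
  => [|n] f hI _ hfGB hfmin b phi hphi e he _ _ _ ltT hltT; last first.
  exact: (Phi_mx_groebner hltR hdeg hI hfGB hfmin hphi he hltT).
have mo := inverse_block_order_mo hltR hltT.
apply: (groebner_basisP mo) => [g Gg|p _ _].
  exact: (@mem_ideal_gen _ (fun x => x \in _)).
(* For m = 0 the minors of size 0 are empty determinants, so 1 is among them and its lead divides
   every monomial. *)
exists 1; split; [|exact: oner_neq0|].
  pose s : {ffun 'I_0 -> 'I_1} := [ffun=> ord0].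
  have s_inc : s \in enum (increasing 0 1).
    by rewrite mem_enum inE; apply/forallP => -[].
  have -> : 1 = \det (mxsub s s (Phi_mx phi)) by rewrite det_mx00.
  exact: allpairs_f.
rewrite (@lead_monoE _ _ mo _ 1 0%MM); first by apply/mnm_lepP => i; rewrite mnm0E.
split=> [|u]; rewrite mcoeff1 ?eqxx ?oner_eq0 //.
by case: (eqVneq u 0%MM) => [->|_]; [left | rewrite eqxx].
Qed.
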